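(* Let $G/H$ be a homogeneous space, and let $g$ and $\bar g$ be two $G$-invariant pseudo-Riemannian metrics (of arbitrary signatures) on $G/H$. If $g$ and $\bar g$ are geodesically equivalent, then they are affinely equivalent.
   Context: A homogeneous space $G/H$ is the quotient of a Lie group $G$ by a closed subgroup $H$, with $G$ acting transitively by left translations; all manifolds are assumed connected and of dimension $n\ge 2$. A metric is a smooth Riemannian or pseudo-Riemannian metric of arbitrary signature; it is $G$-invariant if $G$ acts on $G/H$ by isometries. A metric $\bar g$ on a manifold $M$ is geodesically equivalent to a metric $g$ on $M$ if every geodesic of $g$ is a reparameterized geodesic of $\bar g$ (i.e. the two metrics have the same unparameterized geodesics). Two metrics are affinely equivalent if their Levi-Civita connections coincide. *)

(* Defs.v *)
From HB Require Import structures.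
From mathcomp Require Import all_boot all_order all_algebra.
From mathcomp Require Import all_classical all_reals all_analysis.
From mathcomp Require Import lra.

Set Implicit Arguments.
Unset Strict Implicit.
Unset Printing Implicit Defensive.

Import Order.TTheory GRing.Theory Num.Theory.
Import numFieldNormedType.Exports.

Local Open Scope classical_set_scope.
Local Open Scope ring_scope.

Section Smoothness.
Context {R : realType}.

(* Meant for U open and V finite-dimensional, where f is C^(k+1) on U iff it
   is differentiable on U with all its directional derivatives C^k. *)
Fixpoint Ck_on (V W : normedModType R) (k : nat) (U : set V) (f : V -> W) :
    Prop :=
  match k with
  | 0 => {in U, continuous f}
  | k'.+1 => {in U, forall x, differentiable f x} /\
             forall v, Ck_on k' U (fun x => 'D_v f x)
  end.

Definition smooth_on (V W : normedModType R) (U : set V) (f : V -> W) : Prop :=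
  forall k, Ck_on k U f.

End Smoothness.

Section Manifolds.
Context {R : realType}.

(* A chart of M with values in the model space E. The maps are total: chart_map
   is relevant only on chart_dom, and chart_inv only on chart_im. *)
Record chart (E : normedModType R) (M : topologicalType) := Chart {
  chart_dom : set M;
  chart_map : M -> E;
  chart_inv : E -> M
}.

Definition chart_im (E : normedModType R) (M : topologicalType)
    (c : chart E M) : set E := chart_map c @` chart_dom c.

Record is_chart (E : normedModType R) (M : topologicalType) (c : chart E M) :
    Prop := IsChart {
  chart_dom_open : open (chart_dom c);
  chart_im_open : open (chart_im c);
  chart_mapK : {in chart_dom c, cancel (chart_map c) (chart_inv c)};
  chart_map_continuous : {in chart_dom c, continuous (chart_map c)};
  chart_inv_continuous : {in chart_im c, continuous (chart_inv c)}
}.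

Definition smooth_map (E F : normedModType R) (M N : topologicalType)
    (A : set (chart E M)) (B : set (chart F N)) (f : M -> N) : Prop :=
  continuous f /\
  forall a b, A a -> B b ->
    smooth_on (chart_map a @` (chart_dom a `&` f @^-1` chart_dom b))
              (chart_map b \o f \o chart_inv a).

(* A is an atlas, not necessarily maximal, of a smooth n-dimensional manifold;
   the last field says that the transition maps are smooth. *)
Record smooth_structure (n : nat) (M : topologicalType)
    (A : set (chart 'rV[R]_n M)) : Prop := SmoothStructure {
  manifold_hausdorff : hausdorff_space M;
  manifold_second_countable : @second_countable M;
  atlas_chart : forall c, A c -> is_chart c;
  atlas_cover : forall p, exists2 c, A c & chart_dom c p;
  atlas_compat : smooth_map A A idfun
}.

Definition prod_chart (E F : normedModType R) (M N : topologicalType)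
    (a : chart E M) (b : chart F N) : chart (E * F)%type (M * N)%type :=
  Chart (chart_dom a `*` chart_dom b)
        (fun p : M * N => (chart_map a p.1, chart_map b p.2))
        (fun x : E * F => (chart_inv a x.1, chart_inv b x.2)).

Definition prod_atlas (E F : normedModType R) (M N : topologicalType)
    (A : set (chart E M)) (B : set (chart F N)) :
    set (chart (E * F)%type (M * N)%type) :=
  [set prod_chart a b | a in A & b in B].

Definition diffeomorphism (E : normedModType R) (M : topologicalType)
    (A : set (chart E M)) (f : M -> M) : Prop :=
  smooth_map A A f /\
  exists f', [/\ cancel f f', cancel f' f & smooth_map A A f'].

(* Vectors are rows, so that the differential of F at x is v |-> v *m 'J F x;
   it is onto iff 'J F x is row_full. *)
Definition local_jacobian (m n : nat) (M N : topologicalType)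
    (a : chart 'rV[R]_m M) (b : chart 'rV[R]_n N) (f : M -> N) (p : M) :
    'M[R]_(m, n) :=
  jacobian (chart_map b \o f \o chart_inv a) (chart_map a p).

Definition smooth_submersion (m n : nat) (M N : topologicalType)
    (A : set (chart 'rV[R]_m M)) (B : set (chart 'rV[R]_n N)) (f : M -> N) :
    Prop :=
  smooth_map A B f /\
  forall a b p, A a -> B b -> chart_dom a p -> chart_dom b (f p) ->
    row_full (local_jacobian a b f p).

End Manifolds.

(* No compatibility between the topology and the group law is required here. *)
#[short(type="preTopologicalGroupType")]
HB.structure Definition PreTopologicalGroup := {G of Topological G & Group G}.

HB.mixin Record isLieGroup (R : realType) (m : nat) (G : Type)
    & PreTopologicalGroup G := {
  lie_atlas : set (chart 'rV[R]_m G);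
  lie_smooth_structure : smooth_structure lie_atlas;
  lie_mul_smooth : smooth_map (prod_atlas lie_atlas lie_atlas) lie_atlas
                     (fun p : G * G => (p.1 * p.2)%g);
  lie_inv_smooth : smooth_map lie_atlas lie_atlas (fun x : G => (x^-1)%g)
}.

#[short(type="lieGroupType")]
HB.structure Definition LieGroup (R : realType) (m : nat) :=
  {G of PreTopologicalGroup G & isLieGroup R m G}.

Section CosetSpace.
Local Open Scope group_scope.
Local Open Scope quotient_scope.
Context {G : preTopologicalGroupType} (H : groupClosed G).

Definition coset_rel (x y : G) : bool := x^-1 * y \in H.

Lemma coset_rel_refl : reflexive coset_rel.
Proof. by move=> x; rewrite /coset_rel mulVg gpred1. Qed.

Lemma coset_rel_sym : symmetric coset_rel.
Proof. by move=> x y; rewrite /coset_rel -gpredV invgM invgK. Qed.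

Lemma coset_rel_trans : transitive coset_rel.
Proof.
move=> y x z xy yz; rewrite /coset_rel.
have -> : x^-1 * z = (x^-1 * y) * (y^-1 * z) by rewrite -mulgA mulVKg.
exact: gpredM.
Qed.

Canonical coset_equiv : equiv_rel G :=
  EquivRel coset_rel coset_rel_refl coset_rel_sym coset_rel_trans.

Definition coset_space := quotient_topology {eq_quot coset_equiv}.

HB.instance Definition _ := Topological.on coset_space.
HB.instance Definition _ := Quotient.on coset_space.

Definition coset_proj (x : G) : coset_space := \pi_coset_space x.

Definition ltranslation (a : G) (q : coset_space) : coset_space :=
  coset_proj (a * repr q).

Lemma coset_projE (x y : G) :
  coset_proj x = coset_proj y <-> x^-1 * y \in H.
Proof. by split=> [/eqmodP|xy] //; apply/eqmodP. Qed.

Lemma ltranslationE (a x : G) :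
  ltranslation a (coset_proj x) = coset_proj (a * x).
Proof.
apply/coset_projE; rewrite invgM -mulgA mulKg.
by apply/coset_projE; rewrite /coset_proj reprK.
Qed.

End CosetSpace.

(* G/H carries exactly one smooth structure (up to the choice of an atlas) for
   which the projection from G is a smooth submersion. *)
Definition homogeneous_structure (R : realType) (m n : nat)
    (G : lieGroupType R m) (H : groupClosed G)
    (A : set (chart 'rV[R]_n (coset_space H))) : Prop :=
  smooth_structure A /\ smooth_submersion lie_atlas A (@coset_proj G H).

Section Metrics.
Context {R : realType} {n : nat} {M : topologicalType}.
Implicit Types (A : set (chart 'rV[R]_n M)) (c : chart 'rV[R]_n M).

(* The field of symmetric bilinear forms with coefficients g c x i j (at the
   point of coordinates x, in the chart c) is equal to its pull-back by f. *)
Definition preserves A (g : chart 'rV[R]_n M -> 'rV[R]_n -> 'M[R]_n)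
    (f : M -> M) : Prop :=
  forall c c' p, A c -> A c' -> chart_dom c p -> chart_dom c' (f p) ->
    g c (chart_map c p) =
      local_jacobian c c' f p *m g c' (chart_map c' (f p))
        *m (local_jacobian c c' f p)^T.

(* A pseudo-Riemannian metric is given by its coefficients in the charts of A;
   metric_tensorial is the transformation law under changes of charts. *)
Record pseudo_riemannian A := PseudoRiemannian {
  metric_coef :> chart 'rV[R]_n M -> 'rV[R]_n -> 'M[R]_n;
  metric_smooth : forall c, A c -> smooth_on (chart_im c) (metric_coef c);
  metric_symmetric : forall c, A c ->
    {in chart_im c, forall x, (metric_coef c x)^T = metric_coef c x};
  metric_nondegenerate : forall c, A c ->
    {in chart_im c, forall x, metric_coef c x \in unitmx};
  metric_tensorial : preserves A metric_coef idfun
}.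

Definition isometry A (g : pseudo_riemannian A) (f : M -> M) : Prop :=
  diffeomorphism A f /\ preserves A g f.

Definition partial (i : 'I_n) (f : 'rV[R]_n -> R) (x : 'rV[R]_n) : R :=
  'D_(delta_mx 0 i) f x.

(* The Christoffel symbol of upper index k and lower indices i, j. *)
Definition christoffel (g : 'rV[R]_n -> 'M[R]_n) (x : 'rV[R]_n)
    (k i j : 'I_n) : R :=
  2^-1 * \sum_l invmx (g x) k l *
    (partial i (fun y => g y j l) x + partial j (fun y => g y i l) x
     - partial l (fun y => g y i j) x).

Definition levi_civita A (g : pseudo_riemannian A) c (x : 'rV[R]_n)
    (k i j : 'I_n) : R := christoffel (g c) x k i j.

(* These coefficients are the only torsion-free ones for which the covariant
   derivative of g vanishes. *)
Lemma levi_civitaP A (g : pseudo_riemannian A) c (x : 'rV[R]_n)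
    (Gam : 'I_n -> 'I_n -> 'I_n -> R) :
  smooth_structure A -> A c -> chart_im c x ->
  ((forall k i j, Gam k i j = Gam k j i) /\
   (forall k i j, partial k (fun y => g c y i j) x =
      \sum_l (Gam l k i * g c x l j + Gam l k j * g c x i l)))
  <-> (forall k i j, Gam k i j = levi_civita g c x k i j).
Proof.
move=> sA Ac cx; pose S l i j := \sum_k g c x l k * Gam k i j.
have gC i j : g c x i j = g c x j i.
  by rewrite -{1}(metric_symmetric g Ac (mem_set cx)) mxE.
have dC k i j : partial k (fun y => g c y i j) x
              = partial k (fun y => g c y j i) x.
  apply: near_eq_derive; have /open_nbhs_nbhs : open_nbhs x (chart_im c).
    by split=> //; apply: chart_im_open; apply: atlas_chart sA _ Ac.
  apply: filterS => y cy.
  by rewrite -{1}(metric_symmetric g Ac (mem_set cy)) mxE.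
have gU := metric_nondegenerate g Ac (mem_set cx).
have compatE k i j : \sum_l (Gam l k i * g c x l j + Gam l k j * g c x i l)
                   = S j k i + S i k j.
  rewrite big_split /=; congr (_ + _); apply: eq_bigr => l _; rewrite mulrC //.
  by rewrite gC.
pose T l i j := partial i (fun y => g c y j l) x + partial j (fun y => g c y i l) x
     - partial l (fun y => g c y i j) x.
have GamE : (forall k i j, Gam k i j = levi_civita g c x k i j) <->
   (forall l i j, S l i j = 2^-1 * T l i j).
  pose v i j : 'cV[R]_n := \col_k Gam k i j.
  pose w i j : 'cV[R]_n := \col_l (2^-1 * T l i j).
  have SE l i j : S l i j = (g c x *m v i j) l 0.
    by rewrite mxE; apply: eq_bigr => k _; rewrite mxE.
  have LE k i j : levi_civita g c x k i j = (invmx (g c x) *m w i j) k 0.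
    rewrite mxE /levi_civita /christoffel mulr_sumr; apply: eq_bigr => l _.
    by rewrite mxE mulrCA.
  split=> E; last first.
    move=> k i j; rewrite LE.
    have <- : g c x *m v i j = w i j.
      by apply/colP => l; rewrite -SE E mxE.
    by rewrite mulKmx// mxE.
  move=> l i j; rewrite SE.
  have -> : v i j = invmx (g c x) *m w i j.
    by apply/colP => k; rewrite -LE -E mxE.
  by rewrite mulKVmx// mxE.
split.
- move=> [GC GD]; apply/GamE => l i j; rewrite /T !GD !compatE.
  have SC a b d : S a b d = S a d b by apply: eq_bigr => k _; rewrite GC.
  by rewrite (SC l j i) (SC j l i) (SC i l j); lra.
- move=> E; split.
    move=> k i j; rewrite !E /levi_civita /christoffel; congr (_ * _).
    apply: eq_bigr => l _; rewrite (dC l i j); congr (_ * (_ - _)).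
    by rewrite addrC.
  move/GamE: E => E k i j; rewrite compatE !E /T.
  rewrite (dC k j i); lra.
Qed.

Definition affinely_equivalent A (g gbar : pseudo_riemannian A) : Prop :=
  forall c, A c -> forall x, chart_im c x ->
    forall k i j, levi_civita g c x k i j = levi_civita gbar c x k i j.

Record is_geodesic A (g : pseudo_riemannian A) (I : set R) (gamma : R -> M) :
    Prop := IsGeodesic {
  geodesic_open : open I;
  geodesic_interval : is_interval I;
  geodesic_nonempty : I !=set0;
  geodesic_continuous : {in I, continuous gamma};
  geodesic_smooth : forall c, A c ->
    smooth_on (I `&` gamma @^-1` chart_dom c) (chart_map c \o gamma);
  geodesic_eq : forall c t, A c -> I t -> chart_dom c (gamma t) ->
    let x := chart_map c \o gamma in
    forall k, derive1n 2 x t 0 k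
      + \sum_i \sum_j levi_civita g c (x t) k i j
          * derive1 x t 0 i * derive1 x t 0 j = 0
}.

(* On an interval, a smooth tau with nowhere vanishing derivative is a
   diffeomorphism onto its image. *)
Definition reparametrization (I : set R) (gamma : R -> M)
    (J : set R) (sigma : R -> M) : Prop :=
  exists tau : R -> R,
    [/\ smooth_on I tau, {in I, forall t, derive1 tau t != 0},
        tau @` I = J & {in I, gamma =1 sigma \o tau}].

Definition geodesically_equivalent A (g gbar : pseudo_riemannian A) : Prop :=
  forall I gamma, is_geodesic g I gamma ->
    exists J sigma, is_geodesic gbar J sigma /\
      reparametrization I gamma J sigma.

End Metrics.

Definition invariant_metric (R : realType) (m n : nat) (G : lieGroupType R m)
    (H : groupClosed G) (A : set (chart 'rV[R]_n (coset_space H)))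
    (g : pseudo_riemannian A) : Prop :=
  forall a : G, isometry g (ltranslation a).

(* Main.v *)
Require Import Defs.
From HB Require Import structures.
From mathcomp Require Import all_boot all_order all_algebra.
From mathcomp Require Import all_classical all_reals all_analysis.
From mathcomp Require Import perm ring lra.

Set Implicit Arguments.
Unset Strict Implicit.
Unset Printing Implicit Defensive.

Import Order.TTheory GRing.Theory Num.Theory.
Import numFieldNormedType.Exports.

Local Open Scope classical_set_scope.
Local Open Scope ring_scope.

(** If g and gbar have the same unparameterized geodesics, then in every chart
    the difference of their connections maps each vector v to a multiple of
    itself: writing a geodesic of g with velocity v as a reparameterized
    geodesic of gbar, the second derivative of the parameter change only
    contributes a multiple of v (conn_quad_reparametrized). A symmetric tensor
    with this property is determined by its traces, because it has the form
    D^k_ij = delta^k_i phi_j + delta^k_j phi_i; in particular it is zero if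
    they vanish (projective_traceless_eq0).

    The traces of a Levi-Civita connection are the logarithmic derivatives of
    the square root of |det g| (derive_det_metric). An isometry multiplies both
    det g and det gbar by the square of its Jacobian, and left translations act
    transitively, so det gbar / det g is constant in every chart
    (invariant_det_ratio). The two connections therefore have equal traces
    (trace_conn_eq), their difference is trace-free, and it vanishes.

    The first step needs a geodesic of g through every point in every direction
    (exists_geodesic). In one chart it is a solution of an ordinary
    differential equation, obtained from the Picard-Lindelof theorem
    (picard_lindelof), whose solutions are as smooth as the equation
    (ode_smooth). That this curve satisfies the geodesic equation in all the
    other charts is the transformation law of the connection coefficients
    (conn_transition), which rests on the symmetry of second derivatives
    (derive_commute). *)

(** * Maps of class C^k *)

Section NearDiff.
Context {R : realType} {V W : normedModType R}.

Lemma near_eq_differentiable (f g : V -> W) (x : V) :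
  (\forall y \near x, f y = g y) -> differentiable f x -> differentiable g x.
Proof.
move=> fg df.
have E : g \o shift x = cst (g x) + 'd f x +o_ (0 : V) id.
  apply/eqaddoP => e e0.
  have /eqaddoP/(_ e e0) := diff_locally df.
  have fg0 : \forall h \near (0 : V), f (h + x) = g (h + x).
    by have := fg; rewrite (near_shift 0 x) /= subr0.
  apply: filterS2 fg0 => h /= fgh.
  by rewrite -(nbhs_singleton fg) /= !fctE /= fgh.
have D := diff_unique (diff_continuous df) E.
by apply/diff_locallyP; rewrite D; split => //; exact: diff_continuous.
Qed.

Lemma Ck_on_sub k (U U' : set V) (f : V -> W) :
  U' `<=` U -> Ck_on k U f -> Ck_on k U' f.
Proof.
move=> UU'; elim: k f => [|k IH] f /=.
  by move=> cf x xU; apply: cf; apply: mem_set; apply: UU'; exact: set_mem.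
move=> [df Df]; split=> [x xU|v]; last exact: IH.
by apply: df; apply: mem_set; apply: UU'; exact: set_mem.
Qed.

Lemma Ck_on_eq k (U : set V) (f g : V -> W) :
  open U -> {in U, f =1 g} -> Ck_on k U f -> Ck_on k U g.
Proof.
move=> oU; elim: k f g => [|k IH] f g fg /=.
  move=> cf x xU; have fgx : \forall y \near x, f y = g y.
    have := open_nbhs_nbhs (conj oU (set_mem xU)); apply: filterS => y yU.
    by apply: fg; exact: mem_set.
  rewrite /continuous_at -(nbhs_singleton fgx).
  by apply: cvg_trans (cf x xU); exact: near_eq_cvg.
move=> [df Df].
have fgx x : x \in U -> \forall y \near x, f y = g y.
  move=> xU; have := open_nbhs_nbhs (conj oU (set_mem xU)).
  by apply: filterS => y yU; apply: fg; exact: mem_set.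
split=> [x xU|v]; first by apply: near_eq_differentiable (df x xU); exact: fgx.
by apply: IH (Df v) => x xU; apply: near_eq_derive; exact: fgx.
Qed.

Lemma Ck_on_le k l (U : set V) (f : V -> W) :
  (k <= l)%N -> Ck_on l U f -> Ck_on k U f.
Proof.
elim: k l f => [|k IH] [|l] f //= kl [df Df].
  by move=> x xU; apply: differentiable_continuous; exact: df.
by split=> // v; exact: IH (Df v).
Qed.

Lemma Ck_on_cst k (U : set V) (a : W) : Ck_on k U (fun=> a).
Proof.
elim: k a => [|k IH] a /=; first by move=> x _; exact: cvg_cst.
split=> [x _|v]; first exact: differentiable_cst.
by have -> : (fun x => 'D_v (fun=> a) x) = (fun=> 0 : W);
  [apply/funext => x; exact: derive_cst | exact: IH].
Qed.

Lemma Ck_on_add k (U : set V) (f g : V -> W) : open U ->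
  Ck_on k U f -> Ck_on k U g -> Ck_on k U (fun x => f x + g x).
Proof.
move=> oU; elim: k f g => [|k IH] f g /=.
  by move=> cf cg x xU; apply: cvgD; [exact: cf|exact: cg].
move=> [df Df] [dg Dg]; split=> [x xU|v].
  by apply: differentiableD; [exact: df|exact: dg].
apply: Ck_on_eq (IH _ _ (Df v) (Dg v)) => // x xU.
by rewrite -deriveD //; apply: diff_derivable; [exact: df|exact: dg].
Qed.

Lemma Ck_on_sum (I : Type) (r : seq I) (P : pred I) k (U : set V)
    (F : I -> V -> W) : open U -> (forall i, Ck_on k U (F i)) ->
  Ck_on k U (fun x => \sum_(i <- r | P i) F i x).
Proof.
move=> oU CF; elim: r => [|i r IH].
  by apply: Ck_on_eq (Ck_on_cst k U (0 : W)) => // x _; rewrite big_nil.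
apply: (@Ck_on_eq _ _ (fun x => (if P i then F i x else 0)
                     + \sum_(j <- r | P j) F j x)) => //.
  by move=> x _; rewrite big_cons; case: ifP => //; rewrite add0r.
apply: Ck_on_add => //; case: (P i); [exact: CF|exact: Ck_on_cst].
Qed.

Lemma Ck_on_differentiable k (U : set V) (f : V -> W) (x : V) :
  Ck_on k.+1 U f -> U x -> differentiable f x.
Proof. by case=> df _ xU; apply: df; exact: mem_set. Qed.

End NearDiff.

Section CkScalar.
Context {R : realType} {V : normedModType R}.

(** The derivative of a product involves the factors themselves, known at order
    k + 1, at order k: the induction goes through Ck_on_le. *)
Lemma Ck_on_mul k (U : set V) (f g : V -> R) : open U ->
  Ck_on k U f -> Ck_on k U g -> Ck_on k U (fun x => f x * g x).
Proof.
move=> oU; elim: k f g => [|k IH] f g.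
  by move=> cf cg x xU; apply: cvgM; [exact: cf|exact: cg].
move=> Cf Cg; have [df Df] := Cf; have [dg Dg] := Cg; split=> [x xU|v].
  by apply: differentiableM; [exact: df|exact: dg].
have cf := Ck_on_le (leqnSn k) Cf; have cg := Ck_on_le (leqnSn k) Cg.
apply: Ck_on_eq (Ck_on_add oU (IH _ _ cf (Dg v)) (IH _ _ cg (Df v))) => // x xU.
rewrite -[_ + _](@deriveM _ _ f g) //; apply: diff_derivable.
  exact: df.
exact: dg.
Qed.

Lemma Ck_on_opp k (U : set V) (f : V -> R) : open U ->
  Ck_on k U f -> Ck_on k U (fun x => - f x).
Proof.
move=> oU Cf.
apply: Ck_on_eq (Ck_on_mul oU (Ck_on_cst k U (-1 : R)) Cf) => // x _.
by rewrite mulN1r.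
Qed.

Lemma Ck_on_prod (I : Type) (r : seq I) (P : pred I) k (U : set V)
    (F : I -> V -> R) : open U -> (forall i, Ck_on k U (F i)) ->
  Ck_on k U (fun x => \prod_(i <- r | P i) F i x).
Proof.
move=> oU CF; elim: r => [|i r IH].
  by apply: Ck_on_eq (Ck_on_cst k U (1 : R)) => // x _; rewrite big_nil.
apply: (@Ck_on_eq _ _ _ _ _ (fun x => (if P i then F i x else 1)
                     * \prod_(j <- r | P j) F j x)) => //.
  by move=> x _; rewrite big_cons; case: ifP => //; rewrite mul1r.
apply: Ck_on_mul => //; case: (P i); [exact: CF|exact: Ck_on_cst].
Qed.

Lemma Ck_on_inv k (U : set V) (f : V -> R) : open U ->
  {in U, forall x, f x != 0} -> Ck_on k U f -> Ck_on k U (fun x => (f x)^-1).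
Proof.
move=> oU f0; elim: k => [|k IH].
  by move=> cf x xU; apply: cvgV; [exact: f0|exact: cf].
move=> Cf; have [df Df] := Cf; split=> [x xU|v].
  by apply: differentiableV; [exact: df|exact: f0].
have ci := IH (Ck_on_le (leqnSn k) Cf).
apply: Ck_on_eq (Ck_on_opp oU (Ck_on_mul oU (Ck_on_mul oU ci ci) (Df v))) => //.
move=> x xU; rewrite deriveV ?f0//; last by apply: diff_derivable; exact: df.
by rewrite -exprVn expr2 scaleNr.
Qed.

End CkScalar.

Section CkMatrix.
Context {R : realType} {V : normedModType R}.

Lemma differentiable_mxP m n (f : V -> 'M[R]_(m, n)) x :
  differentiable f x <-> forall i j, differentiable (fun y => f y i j) x.
Proof.
split=> [df i j|df].
  exact: (differentiable_comp df (differentiable_coord (f x) i j)).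
have -> : f = \sum_i \sum_j (fun y => f y i j *: delta_mx i j : 'M[R]_(m, n)).
  apply/funext => y; rewrite [LHS]matrix_sum_delta fct_sumE.
  by apply: eq_bigr => i _; rewrite fct_sumE.
by apply: differentiable_sum => i; apply: differentiable_sum => j;
  exact: differentiableZl.
Qed.

Lemma continuous_mxP m n (f : V -> 'M[R]_(m, n)) x :
  {for x, continuous f} <-> forall i j, {for x, continuous (fun y => f y i j)}.
Proof.
split=> [cf i j|cf].
  apply: (@continuous_comp _ _ _ f (fun M : 'M[R]_(m, n) => M i j)) => //.
  exact: coord_continuous.
apply/cvgrPdist_le => e e0; near=> y.
rewrite /Num.Def.normr/= mx_normrE (bigmax_le _ (ltW e0))//= => i _.
rewrite !mxE/=; move: i; near: y; apply: filter_forall => /= i.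
exact: ((cvgrPdist_le _ _).1 (cf i.1 i.2)).
Unshelve. all: by end_near. Qed.

Lemma derive_mxE m n (f : V -> 'M[R]_(m, n)) x v i j :
  differentiable f x -> ('D_v f x) i j = 'D_v (fun y => f y i j) x.
Proof. by move=> df; rewrite derive_mx ?mxE//; exact: diff_derivable. Qed.

Lemma Ck_on_mxP m n k (U : set V) (f : V -> 'M[R]_(m, n)) : open U ->
  Ck_on k U f <-> forall i j, Ck_on k U (fun y => f y i j).
Proof.
move=> oU; elim: k f => [|k IH] f.
  split=> [cf i j x xU|cf x xU].
    by have /continuous_mxP := cf x xU; exact.
  by apply/continuous_mxP => i j; exact: cf.
split=> [[df Df] i j|Cf].
  split=> [x xU|v]; first by have /differentiable_mxP := df x xU; exact.
  have /IH/(_ i j) := Df v; apply: Ck_on_eq => // x xU.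
  by rewrite derive_mxE//; exact: df.
have df : {in U, forall x, differentiable f x}.
  by move=> x xU; apply/differentiable_mxP => i j; have [+ _] := Cf i j; exact.
split=> // v; apply/IH => i j; have [_ /(_ v)] := Cf i j.
by apply: Ck_on_eq => // x xU; rewrite derive_mxE//; exact: df.
Qed.

(** The determinant is a polynomial in the entries. *)
Lemma Ck_on_det n k (U : set V) (f : V -> 'M[R]_n) : open U ->
  (forall i j, Ck_on k U (fun y => f y i j)) -> Ck_on k U (fun y => \det (f y)).
Proof.
move=> oU Cf; apply: Ck_on_sum => // s; apply: Ck_on_mul => //.
  exact: Ck_on_cst.
exact: Ck_on_prod.
Qed.

(** By Cramer's rule: the cofactors and the inverse of the determinant are
    smooth functions of the entries. *)
Lemma Ck_on_invmx n k (U : set V) (f : V -> 'M[R]_n) i j : open U ->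
  {in U, forall x, f x \in unitmx} ->
  (forall i j, Ck_on k U (fun y => f y i j)) ->
  Ck_on k U (fun y => invmx (f y) i j).
Proof.
move=> oU uf Cf.
apply: (@Ck_on_eq _ _ _ _ _
  (fun y => (\det (f y))^-1 * cofactor (f y) j i)) => //.
  by move=> x xU; rewrite /invmx uf// !mxE.
apply: Ck_on_mul => //.
  apply: Ck_on_inv => //; last exact: Ck_on_det.
  by move=> x xU; rewrite -unitfE -unitmxE; exact: uf.
apply: Ck_on_mul => //; first exact: Ck_on_cst.
apply: Ck_on_det => // a b; apply: Ck_on_eq (Cf (lift j a) (lift i b)) => //.
by move=> x _; rewrite !mxE.
Qed.

End CkMatrix.

Section CkComp.
Context {R : realType}.

Lemma derive_row_sum n (W : normedModType R) (f : 'rV[R]_n -> W) x v :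
  differentiable f x -> 'D_v f x = \sum_i v 0 i *: 'D_(delta_mx 0 i) f x.
Proof.
move=> df; rewrite deriveE// {1}[v]row_sum_delta linear_sum.
by apply: eq_bigr => i _; rewrite linearZ deriveE.
Qed.

Lemma derive_comp (V W X : normedModType R) (u : V -> W) (f : W -> X) x v :
  differentiable u x -> differentiable f (u x) ->
  'D_v (fun y => f (u y)) x = 'D_('D_v u x) f (u x).
Proof.
move=> du df.
have dfu : differentiable (f \o u) x by exact: differentiable_comp.
by rewrite [LHS](deriveE _ dfu) diff_comp// deriveE// deriveE.
Qed.

Lemma derive_comp_row n (V : normedModType R) (u : V -> 'rV[R]_n)
    (f : 'rV[R]_n -> R) x v :
  differentiable u x -> differentiable f (u x) ->
  'D_v (fun y => f (u y)) x =
    \sum_i 'D_v (fun y => u y 0 i) x * partial i f (u x).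
Proof.
move=> du df; rewrite derive_comp// derive_row_sum//.
by apply: eq_bigr => i _; rewrite derive_mxE.
Qed.

(** By the chain rule, the derivatives of the composite are sums of products of
    derivatives of u with composites of partial derivatives of f, to which the
    induction hypothesis applies. The outer function is scalar and lives on a
    space of rows, so that its partial derivatives are again such functions. *)
Lemma Ck_on_comp n (V : normedModType R) k (U : set V) (O : set 'rV[R]_n)
    (u : V -> 'rV[R]_n) (f : 'rV[R]_n -> R) :
  open U -> open O -> (forall x, U x -> O (u x)) ->
  Ck_on k U u -> Ck_on k O f -> Ck_on k U (fun x => f (u x)).
Proof.
move=> oU oO UO; elim: k f => [|k IH] f.
  move=> cu cf x xU; apply: (continuous_comp (cu x xU)); apply: cf.
  by apply: mem_set; apply: UO; exact: set_mem.
move=> Cu Cf; have [du Du] := Cu; have [df Df] := Cf.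
have dfu x : x \in U -> differentiable f (u x).
  by move=> xU; apply: df; apply: mem_set; apply: UO; exact: set_mem.
split=> [x xU|v]; first by apply: differentiable_comp (du x xU) _; exact: dfu.
apply: (@Ck_on_eq _ _ _ _ _ (fun x =>
    \sum_i 'D_v (fun y => u y 0 i) x * partial i f (u x))) => //.
  by move=> x xU; rewrite -derive_comp_row//; [exact: du|exact: dfu].
apply: Ck_on_sum => // i; apply: Ck_on_mul => //.
  have /Ck_on_mxP Cui := Du v; apply: Ck_on_eq (Cui oU 0 i) => // x xU.
  by rewrite derive_mxE//; exact: du.
by apply: IH; [exact: Ck_on_le Cu|exact: Df].
Qed.

Lemma Ck_on_comp_mx n m p (V : normedModType R) k (U : set V) (O : set 'rV[R]_n)
    (u : V -> 'rV[R]_n) (f : 'rV[R]_n -> 'M[R]_(m, p)) :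
  open U -> open O -> (forall x, U x -> O (u x)) ->
  Ck_on k U u -> Ck_on k O f -> Ck_on k U (fun x => f (u x)).
Proof.
move=> oU oO UO Cu /Ck_on_mxP Cf; apply/Ck_on_mxP => // i j.
by apply: Ck_on_comp Cu (Cf oO i j).
Qed.

End CkComp.

(** * Mean value theorem and symmetry of second derivatives *)

Section MeanValue.
Context {R : realType} {V : normedModType R}.

Lemma is_derive_line (W : normedModType R) (f : V -> W) (x v : V) (s : R) :
  differentiable f (x + s *: v) ->
  is_derive s 1 (fun t => f (x + t *: v)) ('D_v f (x + s *: v)).
Proof.
move=> df.
have dl : differentiable (fun t : R => x + t *: v) s.
  apply: (@differentiableD _ _ _ (cst x)) => //.
have Dl : 'D_1 (fun t : R => x + t *: v) s = v.
  rewrite (@deriveD _ _ _ (cst x))//; try exact: diff_derivable.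
  rewrite derive_cst add0r deriveE//.
  by rewrite diff_val scale1r.
rewrite -[X in 'D_X f _]Dl -(@derive_comp _ _ _ _ (fun t : R => x + t *: v))//.
apply/derivableP/diff_derivable.
exact: (@differentiable_comp _ _ _ _ (fun t : R => x + t *: v)).
Qed.

Lemma MVT_line (f : V -> R) (x v : V) (h : R) : 0 <= h ->
  (forall s, 0 <= s <= h -> differentiable f (x + s *: v)) ->
  exists2 s, 0 <= s <= h &
    f (x + h *: v) - f x = h * 'D_v f (x + s *: v).
Proof.
move=> h0 df.
have D s : 0 <= s <= h ->
    is_derive s 1 (fun t => f (x + t *: v)) ('D_v f (x + s *: v)).
  by move=> sh; apply: is_derive_line; exact: df.
have [||s] := @MVT_segment R (fun t => f (x + t *: v))
    (fun s => 'D_v f (x + s *: v)) 0 h h0.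
- by move=> s; rewrite in_itv/= => /andP[s0 sh]; apply: D; rewrite !ltW.
- apply: derivable_within_continuous => s; rewrite in_itv/= => sh.
  by have [] := D _ sh.
rewrite in_itv/= scale0r addr0 subr0 mulrC => sh ->.
by exists s.
Qed.

(** The mean value theorem along v, applied to y |-> f (y + h w) - f y, and
    then along w, applied to 'D_v f. *)
Lemma second_difference (U : set V) (f : V -> R) (x v w : V) (h : R) : 0 < h ->
  Ck_on 2 U f ->
  (forall s t, 0 <= s <= h -> 0 <= t <= h -> U (x + s *: v + t *: w)) ->
  exists s t, [/\ 0 <= s <= h, 0 <= t <= h &
    f (x + h *: v + h *: w) - f (x + h *: v) - (f (x + h *: w) - f x) =
      h ^+ 2 * 'D_w (fun y => 'D_v f y) (x + s *: v + t *: w)].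
Proof.
move=> h0 [df /(_ v)[dDf _]] Uh.
have hh : 0 <= h <= h by rewrite lexx ltW.
have h00 : 0 <= (0 : R) <= h by rewrite lexx ltW.
pose phi y := f (y + h *: w) - f y.
have df1 s : 0 <= s <= h -> differentiable f (x + s *: v).
  move=> sh; apply: df; apply: mem_set.
  by have := Uh s 0 sh h00; rewrite scale0r addr0.
have df2 s : 0 <= s <= h ->
    differentiable (fun y => f (y + h *: w)) (x + s *: v).
  move=> sh; apply: differentiable_comp.
    by apply: (@differentiableD _ _ _ id (cst (h *: w))).
  by apply: df; apply: mem_set; exact: Uh.
have [s sh] := MVT_line (ltW h0)
  (fun s sh => differentiableB (df2 s sh) (df1 s sh)).
rewrite deriveB; [|exact/diff_derivable/df2|exact/diff_derivable/df1].
have -> : 'D_v (fun y => f (y + h *: w)) (x + s *: v)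
        = 'D_v f (x + s *: v + h *: w).
  rewrite derive_comp; last 2 first.
  - by apply: (@differentiableD _ _ _ id (cst (h *: w))).
  - by apply: df; apply: mem_set; exact: Uh.
  rewrite (@deriveD _ _ _ id (cst (h *: w)))// derive_cst addr0.
  by rewrite derive_id.
move=> E.
have [t th E'] := @MVT_line (fun y => 'D_v f y) (x + s *: v) w h (ltW h0)
  (fun t th => dDf _ (mem_set (Uh s t sh th))).
exists s, t; split=> //.
by rewrite expr2 -mulrA -E' -E /= [x + h *: w]addrC addrAC [h *: w + x]addrC.
Qed.

(** Schwarz's theorem: the second difference of f with steps h v and h w is
    symmetric in v and w, so that at some points close to x the two mixed
    derivatives agree; they are continuous at x. *)
Lemma derive_commute (U : set V) (f : V -> R) (x v w : V) : open U -> U x ->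
  Ck_on 2 U f ->
  'D_v (fun y => 'D_w f y) x = 'D_w (fun y => 'D_v f y) x.
Proof.
move=> oU Ux Cf; have [_ Df] := Cf; have [_ Dv] := Df v; have [_ Dw] := Df w.
set A := fun y => 'D_v (fun y => 'D_w f y) y.
set B := fun y => 'D_w (fun y => 'D_v f y) y.
rewrite -[LHS]/(A x) -[RHS]/(B x).
apply/eqP; rewrite -subr_eq0 -normr_le0; apply/ler_addgt0Pl => e e0.
rewrite addr0.
have e2 : 0 < e / 2 by rewrite divr_gt0.
have cA : \forall t \near x, `|A x - A t| < e / 2.
  by move/cvgrPdist_lt: (Dw v x (mem_set Ux)) => /(_ _ e2).
have cB : \forall t \near x, `|B x - B t| < e / 2.
  by move/cvgrPdist_lt: (Dv w x (mem_set Ux)) => /(_ _ e2).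
have nU : nbhs x U.
  by apply: open_nbhs_nbhs; split.
have : \forall t \near x, [/\ U t, `|A x - A t| < e / 2 & `|B x - B t| < e / 2].
  by apply: filterS3 nU cA cB => t; split.
move=> /nbhs_ballP[d d0 dS].
rewrite /= in d0.
(* with this step the points x + p v + q w below stay in the ball of radius d *)
pose h := d / (2 * (`|v| + `|w| + 1)).
have vw0 : 0 < `|v| + `|w| + 1 by rewrite ltr_wpDl// addr_ge0.
have h0 : 0 < h by rewrite divr_gt0// mulr_gt0.
have near_x p q : 0 <= p <= h -> 0 <= q <= h -> ball x d (x + p *: v + q *: w).
  move=> /andP[p0 ph] /andP[q0 qh].
  rewrite -ball_normE /= -addrA opprD addrA subrr sub0r normrN.
  rewrite (le_lt_trans (ler_normD _ _))// !normrZ !ger0_norm//.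
  have hd : h * (`|v| + `|w| + 1) = d / 2.
    by rewrite /h invfM mulrA divfK// gt_eqF.
  have := ler_wpM2r (normr_ge0 v) ph; have := ler_wpM2r (normr_ge0 w) qh.
  lra.
have near_x' p q : 0 <= p <= h -> 0 <= q <= h -> ball x d (x + p *: w + q *: v).
  by move=> ph qh; rewrite addrAC; exact: near_x.
have [s [t [sh th E]]] := second_difference h0 Cf
  (fun s t sh th => let: And3 u _ _ := dS _ (near_x s t sh th) in u).
have [s' [t' [sh' th' E']]] := second_difference h0 Cf
  (fun s t sh th => let: And3 u _ _ := dS _ (near_x' s t sh th) in u).
have BA : B (x + s *: v + t *: w) = A (x + s' *: w + t' *: v).
  apply: (@mulfI _ (h ^+ 2)); first by rewrite sqrf_eq0 gt_eqF.
  have R4 (a b c e' : R) : a - b - (c - e') = a - c - (b - e') by ring.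
  apply: etrans (esym E) _; apply: etrans E'.
  by rewrite R4 [x + h *: w + h *: v]addrAC.
have [_ _ Bx] := dS _ (near_x s t sh th).
have [_ Ax _] := dS _ (near_x' s' t' sh' th').
rewrite -/(A _) -/(B _) in Ax Bx.
rewrite (_ : A x - B x = (A x - A (x + s' *: w + t' *: v))
  - (B x - B (x + s *: v + t *: w))); last first.
  by rewrite BA opprB addrA subrK.
apply: le_trans (ler_normB _ _) _.
by rewrite [leRHS](splitr e); apply: lerD; [exact: ltW Ax|exact: ltW Bx].
Qed.

End MeanValue.

(** * Preliminaries on real and matrix-valued functions *)

Section Real.
Context {R : realType}.

(** The sequences x_k - 2 C / 2^k and x_k + 2 C / 2^k are monotone and enclose
    the limit, which is the supremum of the first one. *)
Lemma geometric_limit (x : nat -> R) (C : R) : 0 <= C ->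
  (forall k, `|x k.+1 - x k| <= C * 2^-1 ^+ k) ->
  exists l, forall k, `|x k - l| <= 2 * C * 2^-1 ^+ k.
Proof.
move=> C0 dx; pose a k := x k - 2 * C * 2^-1 ^+ k.
pose b k := x k + 2 * C * 2^-1 ^+ k.
have q0 k : 0 <= (2^-1 : R) ^+ k by rewrite exprn_ge0.
have aS k : a k <= a k.+1.
  by have := dx k; rewrite ler_norml /a exprS => /andP[]; lra.
have bS k : b k.+1 <= b k.
  by have := dx k; rewrite ler_norml /b exprS => /andP[]; lra.
have ab k : a k <= b k by have := mulr_ge0 C0 (q0 k); rewrite /a /b; lra.
have aD k j : a k <= a (k + j)%N.
  by elim: j => [|j IH]; rewrite ?addn0// addnS (le_trans IH).
have bD k j : b (k + j)%N <= b k.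
  by elim: j => [|j IH]; rewrite ?addn0// addnS (le_trans (bS _)).
have abj j k : a j <= b k.
  by rewrite (le_trans (aD j k))// (le_trans (ab _))// addnC.
exists (sup (range a)) => k.
have up : sup (range a) <= b k.
  by apply: ge_sup; [exists (a 0%N), 0%N|move=> _ [j _ <-]].
have lo : a k <= sup (range a).
  by apply: ub_le_sup; [exists (b 0%N) => _ [j _ <-]|exists k].
by rewrite ler_norml; move: up lo; rewrite /a /b; lra.
Qed.

Lemma le_geometric (a b C : R) :
  (forall k, a <= b + C * 2^-1 ^+ k) -> a <= b.
Proof.
move=> H; rewrite leNgt; apply/negP => ba.
have ab0 : 0 < a - b by rewrite subr_gt0.
set q := `|C| / (a - b).
have q0 : 0 <= q by rewrite divr_ge0// ltW.
have := archi_boundP q0; set k := Num.bound q => qk.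
have k2 : k%:R <= (2 : R) ^+ k by rewrite -natrX ler_nat ltnW// ltn_expl.
have : `|C| < (a - b) * 2 ^+ k.
  by rewrite mulrC -ltr_pdivrMr// (lt_le_trans qk).
rewrite -ltr_pdivrMr ?exprn_gt0// -exprVn => Ck.
have := H k; have : C * 2^-1 ^+ k <= `|C| * 2^-1 ^+ k.
  by rewrite ler_wpM2r ?exprn_ge0// ler_norm.
by move: Ck; lra.
Qed.

Definition clamp (a b t : R) : R := Num.max a (Num.min b t).

Lemma clamp_itv (a b t : R) : a <= b -> a <= clamp a b t <= b.
Proof. by rewrite /clamp /Num.max /Num.min; case: ifP; case: ifP; lra. Qed.

Lemma clamp_id (a b t : R) : a <= t <= b -> clamp a b t = t.
Proof. by rewrite /clamp /Num.max /Num.min; case: ifP; case: ifP; lra. Qed.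

Lemma clamp_lip (a b s t : R) : `|clamp a b s - clamp a b t| <= `|s - t|.
Proof.
wlog st : s t / s <= t.
  by move=> H; have [/H//|/ltW/H] := leP s t; rewrite distrC [leRHS]distrC.
rewrite distrC [leRHS]distrC !ger0_norm ?subr_ge0//.
  by rewrite /clamp /Num.max /Num.min; do 4 case: ifP; lra.
by rewrite /clamp /Num.max /Num.min; do 4 case: ifP; lra.
Qed.

(** The bounds -1 and 1 only serve to integrate over a fixed compact interval;
    the solutions constructed below live on shorter intervals around 0. *)
Lemma continuous_primitive (h : R -> R) : continuous h ->
  exists H : R -> R, H 0 = 0 /\
    forall t : R, -1 < t < 1 -> is_derive t 1 H (h t).
Proof.
move=> ch; pose H0 (x : R) : R :=
  (\int[lebesgue_measure]_(t in [set` `[(-1), x]]) h t)%R.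
exists (fun x => H0 x - H0 0); split; first by rewrite subrr.
move=> t /andP[t1 t2].
have hi : lebesgue_measure.-integrable `[(-1), 1] (EFin \o h).
  apply: continuous_compact_integrable; first exact: segment_compact.
  exact: continuous_subspaceT.
have [D1 D2] := continuous_FTC1_closed t2 hi t1 (ch t).
have D : is_derive t 1 H0 (h t).
  by apply: DeriveDef; [exact: D1|rewrite -derive1E; exact: D2].
have := is_deriveB D (is_derive_cst (H0 0) t 1).
by rewrite subr0.
Qed.

End Real.

Section Vector.
Context {R : realType} {m n : nat}.
Implicit Types (x : 'M[R]_(m, n)).

Lemma norm_mx_le x (C : R) : 0 <= C -> (forall i j, `|x i j| <= C) -> `|x| <= C.
Proof.
by move=> C0 xC; rewrite /Num.Def.normr/= mx_normrE (bigmax_le _ C0).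
Qed.

Lemma norm_coord_le x i j : `|x i j| <= `|x|.
Proof.
by rewrite [leRHS]/Num.Def.normr/= mx_normrE; exact: (le_bigmax _ _ (i, j)).
Qed.

Lemma is_derive_mxP (f : R -> 'M[R]_(m, n)) (t : R) (d : 'M[R]_(m, n)) :
  is_derive t 1 f d <-> forall i j, is_derive t 1 (fun s => f s i j) (d i j).
Proof.
split=> [[df <-] i j|D].
  have /derivable1_diffP dif := df.
  rewrite derive_mxE//; apply/derivableP; exact: (derivable_mxP _ _ _).1.
have df : derivable f t 1 by apply/derivable_mxP => i j; have [] := D i j.
split=> //; apply/matrixP => i j.
rewrite derive_mxE; last exact/derivable1_diffP.
by have [] := D i j.
Qed.

(** Entrywise from the mean value theorem, as the norm of a matrix is the
    largest absolute value of its entries. *)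
Lemma mean_value_inequality (f df : R -> 'M[R]_(m, n)) (a b C : R) :
  0 <= C -> (forall t : R, a <= t <= b -> is_derive t 1 f (df t)) ->
  (forall t, a <= t <= b -> `|df t| <= C) ->
  forall s t, a <= s <= b -> a <= t <= b -> `|f s - f t| <= C * `|s - t|.
Proof.
move=> C0 D dfC s t.
wlog ts : s t / t <= s.
  move=> H; have [ts|/ltW st] := leP t s; first exact: H.
  by move=> sab tab; rewrite distrC [`|s - t|]distrC; exact: H.
move=> /andP[sa sb] /andP[ta tb].
apply: norm_mx_le; first by rewrite mulr_ge0.
move=> i j.
pose F (r : R) : R := f r i j; pose dF (r : R) : R := df r i j.
have Dij (r : R) : r \in `[t, s] -> is_derive r 1 F (dF r).
  rewrite in_itv/= => /andP[tr rs].
  have /is_derive_mxP : is_derive r 1 f (df r); last exact.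
  apply: D.
  by rewrite (le_trans ta)// (le_trans rs).
have DF (r : R) : r \in `]t, s[ -> is_derive r 1 F (dF r).
  by move=> rI; apply: Dij; exact: subset_itv_oo_cc rI.
have cF : {within `[t, s], continuous F}.
  by apply: derivable_within_continuous => r /Dij[].
have [r] := MVT_segment ts DF cF.
rewrite in_itv/= => /andP[tr rs] E; rewrite !mxE -/(F s) -/(F t) E normrM.
rewrite ler_wpM2r// (le_trans (norm_coord_le _ _ _))//; apply: dfC.
by rewrite (le_trans ta)// (le_trans rs).
Qed.

Lemma lipschitz_continuous (f : R -> 'M[R]_(m, n)) (C : R) :
  0 <= C -> (forall s t, `|f s - f t| <= C * `|s - t|) -> continuous f.
Proof.
move=> C0 fC t; have C1 : 0 < C + 1 by rewrite ltr_wpDl.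
apply/cvgrPdist_lt => e e0; near=> s.
apply: le_lt_trans (fC t s) _.
have : `|t - s| < e / (C + 1).
  near: s; apply/nbhs_ballP; exists (e / (C + 1)).
    exact: (divr_gt0 e0 C1).
  by [].
rewrite ltr_pdivlMr// => tse; apply: le_lt_trans tse.
by rewrite mulrC ler_wpM2l// lerDl.
Unshelve. all: by end_near. Qed.

(** Choosing the primitives once and for all makes Picard's operator a
    function. *)
Lemma primitive_mx : exists prim : (R -> 'M[R]_(m, n)) -> R -> 'M[R]_(m, n),
  forall h, continuous h -> prim h 0 = 0 /\
    forall t : R, -1 < t < 1 -> is_derive t 1 (prim h) (h t).
Proof.
suff H (h : R -> 'M[R]_(m, n)) : exists H, continuous h -> H 0 = 0 /\
    forall t : R, -1 < t < 1 -> is_derive t 1 H (h t).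
  by have [prim primP] := choice H; exists prim.
have [ch|] := pselect (continuous h); last by exists (fun=> 0).
have chij i j : continuous (fun t => h t i j : R).
  by move=> t; apply: (continuous_mxP _ _).1; exact: ch.
have [P PP] := choice (fun ij : 'I_m * 'I_n =>
  continuous_primitive (chij ij.1 ij.2)).
exists (fun t => \matrix_(i, j) P (i, j) t) => _; split.
  by apply/matrixP => i j; rewrite !mxE; have [] := PP (i, j).
move=> t t1; apply/is_derive_mxP => i j.
rewrite (_ : (fun s => _) = P (i, j)); last by apply/funext => s; rewrite !mxE.
by have [_] := PP (i, j); exact.
Qed.

End Vector.

(** * Local existence for ordinary differential equations *)

Section Picard.
Context {R : realType} {N : nat}.

(** Picard iteration. On an interval of radius 1 / (2 (L + 1)) the operator u
    |-> w0 + primitive of F o u halves distances, so its iterates converge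
    uniformly and the limit is a fixed point. With the time t replaced by its
    clamped value c t, all the iterates are B-Lipschitz on the whole line,
    hence so is their limit, which is thus continuous. *)
Lemma picard_global (F : 'rV[R]_N -> 'rV[R]_N) (L B : R) (w0 : 'rV[R]_N) :
  0 <= L -> 0 <= B ->
  (forall x y, `|F x - F y| <= L * `|x - y|) -> (forall x, `|F x| <= B) ->
  exists2 e : R, 0 < e & exists u : R -> 'rV[R]_N, [/\ u 0 = w0,
    forall s t, `|u s - u t| <= B * `|s - t| &
    forall t : R, -e < t < e -> is_derive t 1 u (F (u t))].
Proof.
move=> L0 B0 FL FB.
have [prim primP] := @primitive_mx R 1 N.
(* small enough for contraction, as L e <= 1/2, and for the primitives to be
   defined, as e < 1 *)
pose e : R := (2 * (L + 1))^-1.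
have e0 : 0 < e by rewrite invr_gt0; lra.
have e1 : e <= 2^-1 by rewrite lef_pV2 ?posrE; lra.
have Le : L * e <= 2^-1.
  rewrite /e invfM mulrCA ler_piMr ?invr_ge0//.
  by rewrite ler_pdivrMr ?mul1r; lra.
pose c (t : R) := clamp (- e) e t.
have c_itv t : - e <= c t <= e by apply: clamp_itv; lra.
have c0 : c 0 = 0 by apply: clamp_id; lra.
have e_itv t : - e <= t <= e -> -1 < t < 1 by lra.
pose step (u : R -> 'rV[R]_N) (t : R) : 'rV[R]_N :=
  w0 + prim (fun s => F (u s)) (c t).
pose lip (u : R -> 'rV[R]_N) := forall s t, `|u s - u t| <= B * `|s - t|.
have cF u : lip u -> continuous (fun s => F (u s)).
  move=> lu; apply: (@lipschitz_continuous _ _ _ _ (L * B)).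
    exact: mulr_ge0.
  move=> s t; apply: le_trans (FL _ _) _.
  by rewrite -mulrA ler_wpM2l.
have prim0 u : lip u -> prim (fun s => F (u s)) 0 = 0.
  by move=> /cF/primP[].
have primD u (t : R) : lip u -> - e <= t <= e ->
    is_derive t 1 (prim (fun s => F (u s))) (F (u t)).
  by move=> /cF/primP[_ H] te; exact: H (e_itv t te).
have lip_step u : lip u -> lip (step u).
  move=> lu s t; rewrite /step opprD addrACA subrr add0r.
  have := @mean_value_inequality _ _ _ (prim (fun s => F (u s))) _ (- e) e B B0
    (fun t => primD u t lu) (fun t _ => FB (u t)) (c s) (c t)
    (c_itv s) (c_itv t).
  move=> H; apply: le_trans H _; rewrite ler_wpM2l//; exact: clamp_lip.
have contr u v C : 0 <= C -> lip u -> lip v ->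
    (forall t, `|u t - v t| <= C) -> forall t, `|step u t - step v t| <= C / 2.
  move=> C0 lu lv uv t; rewrite /step opprD addrACA subrr add0r.
  pose D (t : R) := prim (fun s => F (u s)) t - prim (fun s => F (v s)) t.
  have D0 : D 0 = 0 by rewrite /D !prim0// subrr.
  have := @mean_value_inequality _ _ _ D (fun t => F (u t) - F (v t))
    (- e) e (L * C)
    (mulr_ge0 L0 C0)
    (fun t te => is_deriveB (primD u t lu te) (primD v t lv te)).
  have FC s : - e <= s <= e -> `|F (u s) - F (v s)| <= L * C.
    by move=> _; apply: le_trans (FL _ _) _; rewrite ler_wpM2l.
  have e00 : - e <= 0 <= e by lra.
  move=> /(_ FC (c t) 0 (c_itv t) e00); rewrite D0 !subr0 => H.
  apply: le_trans H _.
  have ce : `|c t| <= e by rewrite ler_norml c_itv.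
  have := ler_wpM2l (mulr_ge0 L0 C0) ce.
  have := ler_wpM2r C0 Le; lra.
pose U k := iter k step (fun=> w0).
have lipU k : lip (U k).
  elim: k => [|k IH]; last exact: lip_step.
  by move=> s t; rewrite /U /= subrr normr0 mulr_ge0.
have dU k t : `|U k.+1 t - U k t| <= B * 2^-1 ^+ k.
  elim: k t => [|k IH] t.
    rewrite /U /= /step addrC addKr expr0 mulr1.
    have := @mean_value_inequality _ _ _ (prim (fun s => F w0)) _ (- e) e B B0
      (fun t => primD _ t (lipU 0%N)) (fun t _ => FB w0) (c t) 0 (c_itv t).
    rewrite (prim0 _ (lipU 0%N)) !subr0 => H.
    have e00 : - e <= 0 <= e by lra.
    apply: le_trans (H e00) _; apply: ler_piMr => //.
    rewrite ler_norml; have := c_itv t; lra.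
  rewrite exprSr mulrA; apply: (contr (U k.+1) (U k)) => //.
  by rewrite mulr_ge0// exprn_ge0.
have exl t : exists l : 'rV[R]_N, forall k, `|U k t - l| <= 2 * B * 2^-1 ^+ k.
  have dUi i k : `|U k.+1 t 0 i - U k t 0 i| <= B * 2^-1 ^+ k.
    apply: le_trans (dU k t).
    by have := norm_coord_le (U k.+1 t - U k t) 0 i; rewrite !mxE.
  have [l Hl] := choice (fun i => geometric_limit B0 (dUi i)).
  exists (\row_i l i) => k; apply: norm_mx_le.
    by rewrite mulr_ge0 ?exprn_ge0// mulr_ge0.
  by move=> i j; rewrite !mxE ord1; exact: Hl.
have [u uP] := choice exl.
have lu : lip u.
  move=> s t; apply: (@le_geometric _ _ _ (4 * B)) => k.
  have -> : u s - u t = (U k s - U k t) - (U k s - u s) + (U k t - u t).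
    by apply/rowP => i; rewrite !mxE; ring.
  apply: le_trans (ler_normD _ _) _.
  have := ler_normB (U k s - U k t) (U k s - u s).
  by have := uP s k; have := uP t k; have := lipU k s t; lra.
have us t : u t = step u t.
  apply/eqP; rewrite -subr_eq0 -normr_le0.
  apply: (@le_geometric _ _ _ (3 * B)) => k; rewrite add0r.
  have := contr (U k) u _ _ (lipU k) lu (fun t => uP t k) t.
  have q0 : 0 <= 2 * B * 2^-1 ^+ k by rewrite mulr_ge0 ?exprn_ge0// mulr_ge0.
  move=> /(_ q0); have := uP t k.+1; rewrite -/(U k.+1) exprS.
  have -> : u t - step u t = (U k.+1 t - step u t) - (U k.+1 t - u t).
    by rewrite opprB [RHS]addrC subrKA.
  move=> H1 H2; apply: le_trans (ler_normB _ _) _.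
  move: H1 H2; rewrite /U /= ; lra.
exists e => //; exists u; split=> //.
  by rewrite us /step c0 prim0// addr0.
move=> t te.
have te' : - e <= t <= e by lra.
have : is_derive t 1 (fun s => w0 + prim (fun s => F (u s)) s) (F (u t)).
  have := is_deriveD (is_derive_cst w0 t 1) (primD u t lu te').
  by rewrite add0r.
apply: near_eq_is_derive.
near=> s; rewrite (us s) /step /c clamp_id//.
suff : - e < s < e by lra.
near: s.
have : nbhs t [set` `]- e, e[].
  by apply: open_nbhs_nbhs; split; [exact: interval_open|rewrite /= in_itv].
by apply: filterS => s; rewrite /= in_itv.
Unshelve. all: by end_near. Qed.

(** The mean value theorem on the segment from y to x, which stays in the ball
    since a ball is convex. *)
Lemma lipschitz_box (F : 'rV[R]_N -> 'rV[R]_N) (K r : R) (w0 : 'rV[R]_N) :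
  0 <= K ->
  (forall x, `|x - w0| <= r -> differentiable F x) ->
  (forall x i, `|x - w0| <= r -> `|'D_(delta_mx 0 i) F x| <= K) ->
  forall x y, `|x - w0| <= r -> `|y - w0| <= r ->
    `|F x - F y| <= N%:R * K * `|x - y|.
Proof.
move=> K0 dF FK x y xr yr.
apply: norm_mx_le; first by rewrite !mulr_ge0.
move=> i0 k; rewrite {i0}ord1.
have seg s : 0 <= s <= 1 -> `|y + s *: (x - y) - w0| <= r.
  move=> /andP[s0 s1].
  have -> : y + s *: (x - y) - w0 = (1 - s) *: (y - w0) + s *: (x - w0).
    by apply/rowP => i; rewrite !mxE; ring.
  apply: le_trans (ler_normD _ _) _.
  rewrite !normrZ ger0_norm ?subr_ge0// ger0_norm//.
  have := ler_wpM2l s0 xr.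
  have s1' : 0 <= 1 - s by lra.
  have := ler_wpM2l s1' yr; lra.
have dFk s : 0 <= s <= 1 ->
    differentiable (fun z => F z 0 k) (y + s *: (x - y)).
  by move=> s01; apply: (differentiable_mxP _ _).1; apply: dF; exact: seg.
have [s s01] := MVT_line ler01 dFk.
rewrite scale1r mul1r subrKC !mxE => ->.
rewrite derive_row_sum; last exact: dFk.
apply: le_trans (ler_norm_sum _ _ _) _.
have -> : N%:R * K * `|x - y| = \sum_(i < N) `|x - y| * K.
  by rewrite sumr_const card_ord -[RHS]mulr_natl; ring.
apply: ler_sum => i _; rewrite normrM; apply: ler_pM => //.
  exact: norm_coord_le.
rewrite -derive_mxE; last by apply: dF; exact: seg.
apply: le_trans (norm_coord_le _ _ _) _; apply: FK; exact: seg.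
Qed.

(** On a small closed ball around w0, F is bounded and Lipschitz. Composing it
    with the projection P onto this ball, which for the sup norm is a cube,
    gives a global bounded Lipschitz field; its solution starting at w0 has
    speed at most B, stays in the ball for a while, and there solves the
    original equation. *)
Lemma picard_lindelof (F : 'rV[R]_N -> 'rV[R]_N) (O : set 'rV[R]_N)
    (w0 : 'rV[R]_N) : open O -> O w0 -> Ck_on 1 O F ->
  exists2 e : R, 0 < e & exists u : R -> 'rV[R]_N, u 0 = w0 /\
    forall t : R, -e < t < e -> O (u t) /\ is_derive t 1 u (F (u t)).
Proof.
move=> oO Ow0 CF; have [dF DF] := CF.
have nO : nbhs w0 O by apply: open_nbhs_nbhs; split.
pose K : R := \sum_i `|'D_(delta_mx 0 i) F w0| + 1.
pose B : R := `|F w0| + 1.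
have K0 : 0 <= K by rewrite addr_ge0// sumr_ge0.
have B0 : 0 < B by rewrite ltr_wpDl.
have nK : \forall x \near w0, forall i, `|'D_(delta_mx 0 i) F x| <= K.
  suff H i : \forall x \near w0, `|'D_(delta_mx 0 i) F x| <= K.
    by near=> x; near: x; apply: filter_forall => i; exact: H.
  have /cvgrPdist_lt/(_ 1 ltr01) := DF (delta_mx 0 i) w0 (mem_set Ow0).
  apply: filterS => x xi.
  have Ki : `|'D_(delta_mx 0 i) F w0| + 1 <= K.
    by rewrite lerD2r (bigD1 i)//= lerDl sumr_ge0.
  have aux (a b k d : R) : d < 1 -> b + 1 <= k -> a - b <= d -> a <= k.
    by lra.
  apply: aux xi Ki _; rewrite distrC; exact: lerB_dist.
have nB : \forall x \near w0, `|F x| <= B.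
  have dFw0 := Ck_on_differentiable CF Ow0.
  have /cvgrPdist_lt/(_ 1 ltr01) := differentiable_continuous dFw0.
  apply: filterS => x xi.
  have := lerB_dist (F x) (F w0); rewrite distrC /B; move: xi; lra.
have : \forall x \near w0,
    [/\ O x, forall i, `|'D_(delta_mx 0 i) F x| <= K & `|F x| <= B].
  by apply: filterS3 nO nK nB => x; split.
move=> /nbhs_ballP[d d0 dP]; rewrite /= in d0.
pose r : R := d / 2.
have r0 : 0 < r by rewrite divr_gt0.
have boxP x : `|x - w0| <= r ->
    [/\ O x, forall i, `|'D_(delta_mx 0 i) F x| <= K & `|F x| <= B].
  move=> xr; apply: dP; rewrite -ball_normE /= distrC.
  by apply: le_lt_trans xr _; rewrite /r; lra.
pose P (x : 'rV[R]_N) : 'rV[R]_N :=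
  \row_i clamp (w0 0 i - r) (w0 0 i + r) (x 0 i).
have PK x : `|x - w0| <= r -> P x = x.
  move=> xr; apply/rowP => i; rewrite !mxE clamp_id//.
  have := le_trans (norm_coord_le (x - w0) 0 i) xr.
  by rewrite !mxE ler_norml; lra.
have Pbox x : `|P x - w0| <= r.
  apply: norm_mx_le; first exact: ltW.
  move=> i j; rewrite (ord1 i) !mxE ler_norml.
  have ab : w0 0 j - r <= w0 0 j + r by lra.
  have := clamp_itv (x 0 j) ab; lra.
have Plip x y : `|P x - P y| <= `|x - y|.
  apply: norm_mx_le => // i j; rewrite (ord1 i) !mxE.
  apply: le_trans (clamp_lip _ _ _ _) _.
  by have := norm_coord_le (x - y) 0 j; rewrite !mxE.
have Flip : forall x y, `|x - w0| <= r -> `|y - w0| <= r ->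
    `|F x - F y| <= N%:R * K * `|x - y|.
  apply: lipschitz_box => // [x /boxP[Ox _ _]|x i /boxP[]//].
  exact: Ck_on_differentiable CF Ox.
have L0 : 0 <= N%:R * K by rewrite mulr_ge0.
have FPlip x y : `|F (P x) - F (P y)| <= N%:R * K * `|x - y|.
  by apply: le_trans (Flip _ _ (Pbox x) (Pbox y)) _; rewrite ler_wpM2l.
have FPB x : `|F (P x)| <= B by have [] := boxP _ (Pbox x).
have [e e0 [u [u0 ul ud]]] :=
  picard_global (F := fun x => F (P x)) w0 L0 (ltW B0) FPlip FPB.
(* up to time r / B the solution cannot leave the ball of radius r *)
exists (Num.min e (r / B)).
  by rewrite lt_min e0 divr_gt0.
exists u; split=> // t; rewrite lt_min ltrNl lt_min.
move=> /andP[/andP[t1 t2] /andP[t3 t4]].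
have ut : `|u t - w0| <= r.
  rewrite -u0; apply: le_trans (ul t 0) _.
  rewrite subr0 mulrC -ler_pdivlMr// ler_norml; lra.
split; first by have [] := boxP _ ut.
by have := ud t; rewrite PK//; apply; lra.
Unshelve. all: by end_near. Qed.

End Picard.

(** * Matrix calculus and the geodesic equation in an open set *)

Section MatrixCalculus.
Context {R : realType} {V : normedModType R}.

Lemma differentiable_mulmx m n p (A : V -> 'M[R]_(m, n))
    (B : V -> 'M[R]_(n, p)) x :
  differentiable A x -> differentiable B x ->
  differentiable (fun y => A y *m B y) x.
Proof.
move=> /differentiable_mxP dA /differentiable_mxP dB.
apply/differentiable_mxP => i j.
have -> : (fun y => (A y *m B y) i j) = \sum_k (fun y => A y i k * B y k j).
  by apply/funext => y; rewrite mxE fct_sumE.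
apply: differentiable_sum => k; apply: differentiableM; [exact: dA|exact: dB].
Qed.

Lemma derive_mulmx m n p (A : V -> 'M[R]_(m, n))
    (B : V -> 'M[R]_(n, p)) x v :
  differentiable A x -> differentiable B x ->
  'D_v (fun y => A y *m B y) x = 'D_v A x *m B x + A x *m 'D_v B x.
Proof.
move=> dA dB; apply/matrixP => i j.
rewrite derive_mxE; last exact: differentiable_mulmx.
have /differentiable_mxP dA' := dA; have /differentiable_mxP dB' := dB.
have -> : (fun y => (A y *m B y) i j) = \sum_k (fun y => A y i k * B y k j).
  by apply/funext => y; rewrite mxE fct_sumE.
have dd k : is_derive x v (fun y => A y i k * B y k j)
    (A x i k * 'D_v (fun y => B y k j) x + B x k j * 'D_v (fun y => A y i k) x).
  have hA : derivable (fun y => A y i k) x v by exact: diff_derivable.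
  have hB : derivable (fun y => B y k j) x v by exact: diff_derivable.
  apply: DeriveDef; [exact: (derivableM hA hB)|exact: (deriveM hA hB)].
have [_ ->] := is_derive_sum dd.
rewrite !mxE -big_split; apply: eq_bigr => k _ /=.
by rewrite !derive_mxE// addrC; congr (_ + _); rewrite mulrC.
Qed.

Lemma differentiable_trmx m n (A : V -> 'M[R]_(m, n)) x :
  differentiable A x -> differentiable (fun y => (A y)^T) x.
Proof.
move=> /differentiable_mxP dA; apply/differentiable_mxP => i j.
by under eq_fun do rewrite mxE.
Qed.

Lemma derive_trmx m n (A : V -> 'M[R]_(m, n)) x v :
  differentiable A x -> 'D_v (fun y => (A y)^T) x = ('D_v A x)^T.
Proof.
move=> dA; apply/matrixP => i j.
rewrite derive_mxE; last exact: differentiable_trmx.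
by rewrite mxE derive_mxE//; under eq_fun do rewrite mxE.
Qed.

End MatrixCalculus.

Section Scale.
Context {R : realType} {V : normedModType R} {m n : nat}.

Lemma differentiable_scale (f : V -> R) (w : V -> 'M[R]_(m, n)) x :
  differentiable f x -> differentiable w x ->
  differentiable (fun y => f y *: w y) x.
Proof.
move=> df /differentiable_mxP dw; apply/differentiable_mxP => i j.
under eq_fun do rewrite mxE.
exact: differentiableM.
Qed.

Lemma derive_scale (f : V -> R) (w : V -> 'M[R]_(m, n)) x v :
  differentiable f x -> differentiable w x ->
  'D_v (fun y => f y *: w y) x = f x *: 'D_v w x + 'D_v f x *: w x.
Proof.
move=> df dw; apply/matrixP => i j.
rewrite derive_mxE; last exact: differentiable_scale.
have /differentiable_mxP dw' := dw.
under eq_fun do rewrite mxE.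
rewrite (@deriveM _ _ f (fun y => w y i j)); try exact: diff_derivable.
by rewrite !mxE derive_mxE// [X in _ + X]mulrC.
Qed.

End Scale.

Section Smooth.
Context {R : realType}.

Lemma Ck_on_coord m n k (U : set 'M[R]_(m, n)) i j :
  Ck_on k U (fun w : 'M[R]_(m, n) => w i j : R).
Proof.
case: k => [|k] /=.
  by move=> w _; exact: coord_continuous.
split=> [w _|v]; first exact: differentiable_coord.
have -> : (fun w : 'M[R]_(m, n) => 'D_v (fun w : 'M[R]_(m, n) => w i j : R) w)
    = (fun=> v i j).
  by apply/funext => w; rewrite -(@derive_mxE _ _ _ _ id) ?derive_id.
exact: Ck_on_cst.
Qed.

Lemma derive_real (W : normedModType R) (f : R -> W) (t v : R) :
  differentiable f t -> 'D_v f t = v *: 'D_1 f t.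
Proof. by move=> df; rewrite !deriveE// -linearZ/= [_ *: 1]mulr1. Qed.

Lemma derive1n2E (W : normedModType R) (f : R -> W) t :
  derive1n 2 f t = 'D_1 (fun s => 'D_1 f s) t.
Proof.
rewrite /= derive1E; congr ('D_1 _ t).
by apply/funext => s; rewrite derive1E.
Qed.

(** Bootstrapping: if u is C^k then so is its derivative F o u. *)
Lemma ode_smooth N (F : 'rV[R]_N -> 'rV[R]_N) (O : set 'rV[R]_N) (I : set R)
    (u : R -> 'rV[R]_N) : open O -> open I -> smooth_on O F ->
  (forall t : R, I t -> O (u t) /\ is_derive t 1 u (F (u t))) ->
  smooth_on I u.
Proof.
move=> oO oI CF du k.
have dif t : I t -> differentiable u t.
  by move=> /du[_ [d _]]; apply/derivable1_diffP.
elim: k => [|k IH].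
  by move=> t /set_mem/dif; exact: differentiable_continuous.
split=> [t /set_mem/dif//|v].
have IO t : I t -> O (u t) by move=> /du[].
apply: (@Ck_on_eq _ _ _ _ _ (fun t => v *: F (u t))) => //.
  move=> t /set_mem It; rewrite derive_real; last exact: dif.
  by have [_ [_ ->]] := du t It.
apply/Ck_on_mxP => // i j; under eq_fun do rewrite mxE.
apply: Ck_on_mul => //; first exact: Ck_on_cst.
have /Ck_on_mxP := CF k; move=> /(_ oO i j) Fij.
exact: Ck_on_comp IH Fij.
Qed.

Lemma open_symmetric_itv (e : R) : open [set t : R | - e < t < e].
Proof.
have -> : [set t : R | - e < t < e] = [set` `]- e, e[].
  by apply/seteqP; split=> t; rewrite /= in_itv.
exact: interval_open.
Qed.

Arguments open_symmetric_itv : clear implicits.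

(** The second order equation is the first order system for the pair of the
    position and the velocity, encoded as a row of length n + n. *)
Lemma geodesic_ode n (U : set 'rV[R]_n)
    (Gam : 'rV[R]_n -> 'I_n -> 'I_n -> 'I_n -> R) (x0 v : 'rV[R]_n) :
  open U -> U x0 -> (forall k i j, smooth_on U (fun x => Gam x k i j)) ->
  exists2 e : R, 0 < e & exists x : R -> 'rV[R]_n,
    [/\ x 0 = x0, derive1 x 0 = v, smooth_on [set t : R | -e < t < e] x &
    forall t : R, -e < t < e -> U (x t) /\
      forall k, derive1n 2 x t 0 k +
        \sum_i \sum_j Gam (x t) k i j * derive1 x t 0 i * derive1 x t 0 j = 0].
Proof.
move=> oU Ux0 CG.
pose Q (w : 'rV[R]_(n + n)) k := \sum_i \sum_j
  Gam (lsubmx w) k i j * rsubmx w 0 i * rsubmx w 0 j.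
(* w is the row (position, velocity) *)
pose F (w : 'rV[R]_(n + n)) : 'rV[R]_(n + n) :=
  row_mx (rsubmx w) (- \row_k Q w k).
pose O : set 'rV[R]_(n + n) := lsubmx @^-1` U.
have Cl k (O' : set 'rV[R]_(n + n)) : open O' ->
    Ck_on k O' (fun w : 'rV[R]_(n + n) => lsubmx w : 'rV[R]_n).
  by move=> oO; apply/Ck_on_mxP => // i j; under eq_fun do rewrite mxE;
    exact: Ck_on_coord.
have Cr k (O' : set 'rV[R]_(n + n)) i j :
    Ck_on k O' (fun w : 'rV[R]_(n + n) => rsubmx w i j : R).
  by under eq_fun do rewrite mxE; exact: Ck_on_coord.
have oO : open O.
  apply: open_comp oU => w _.
  by have := Cl 0%N setT openT => /(_ w); apply; exact: in_setT.
have CF : smooth_on O F.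
  move=> k; apply/Ck_on_mxP => // i j.
  have [j' ->|j' ->] := split_ordP j.
    by under eq_fun do rewrite row_mxEl; exact: Cr.
  under eq_fun do rewrite row_mxEr !mxE.
  apply: Ck_on_opp => //; apply: Ck_on_sum => // a; apply: Ck_on_sum => // b.
  apply: Ck_on_mul; [done| |exact: Cr].
  apply: Ck_on_mul; [done| |exact: Cr].
  by apply: (Ck_on_comp oO oU _ (Cl k O oO) (CG _ _ _ k)).
pose w0 : 'rV[R]_(n + n) := row_mx x0 v.
have Ow0 : O w0 by rewrite /O /= row_mxKl.
have [e e0 [u [u0 uP]]] := picard_lindelof oO Ow0 (CF 1%N).
have Cu : smooth_on [set t : R | -e < t < e] u.
  exact: (@ode_smooth _ F O [set t : R | - e < t < e] u oO
    (open_symmetric_itv e) CF uP).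
have du (t : R) : -e < t < e -> differentiable u t.
  by move=> te; exact: Ck_on_differentiable (Cu 1%N) te.
have D1 t : -e < t < e -> 'D_1 (fun t => lsubmx (u t)) t = rsubmx (u t).
  move=> te; apply/matrixP => a b; rewrite derive_mxE; last first.
    by apply: differentiable_comp (du t te) _; exact: differentiable_lsubmx.
  under eq_fun do rewrite mxE.
  rewrite -derive_mxE; last exact: du.
  by have [_ [_ ->]] := uP t te; rewrite row_mxEl.
have D2 t : -e < t < e -> 'D_1 (fun t => rsubmx (u t)) t = - \row_k Q (u t) k.
  move=> te; apply/matrixP => a b; rewrite derive_mxE; last first.
    by apply: differentiable_comp (du t te) _; exact: differentiable_rsubmx.
  under eq_fun do rewrite mxE.
  rewrite -derive_mxE; last exact: du.
  by have [_ [_ ->]] := uP t te; rewrite row_mxEr.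
exists e => //; exists (fun t => lsubmx (u t)).
have ee0 : - e < 0 < e by lra.
split.
- by rewrite u0 row_mxKl.
- by rewrite derive1E D1// u0 row_mxKr.
- move=> k; apply/Ck_on_mxP; first exact: open_symmetric_itv.
  move=> i j.
  rewrite (_ : (fun y => _) = (fun y => u y i (lshift n j))); last first.
    by apply/funext => y; rewrite mxE.
  by have /Ck_on_mxP := Cu k; apply; exact: open_symmetric_itv.
- move=> t te; have [Out _] := uP t te; split=> // k.
  have -> : derive1n 2 (fun t => lsubmx (u t)) t = - \row_k Q (u t) k.
    rewrite /= -(D2 t te) !derive1E; apply: near_eq_derive.
    near=> s; rewrite derive1E; apply: D1; near: s.
    by apply: open_nbhs_nbhs; split; [exact: open_symmetric_itv|].
  by rewrite !derive1E D1// !mxE addrC subrr.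
Unshelve. all: by end_near. Qed.

End Smooth.

(** * The Levi-Civita connection and changes of charts *)

Lemma open_setI_preimage (T S : topologicalType) (U : set T) (D : set S)
    (f : T -> S) :
  open U -> {in U, continuous f} -> open D -> open (U `&` f @^-1` D).
Proof.
move=> oU cf oD; rewrite openE => x [Ux Dx].
apply: filterI; first by apply: open_nbhs_nbhs; split.
by apply: (cf x (mem_set Ux)); apply: open_nbhs_nbhs; split.
Qed.

Lemma mx_addE (T : nmodType) m p (X Y : 'M[T]_(m, p)) i j :
  (X + Y) i j = X i j + Y i j.
Proof. by rewrite mxE. Qed.

Lemma mulmx_entry_eq (T : pzSemiRingType) m p q (X Y : 'M[T]_(m, p))
    (Z : 'M[T]_(p, q)) a b k :
  (forall j, X a j = Y b j) -> (X *m Z) a k = (Y *m Z) b k.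
Proof. by move=> XY; rewrite !mxE; apply: eq_bigr => j _; rewrite XY. Qed.

(** With C a connection, J a Jacobian matrix and H a its derivatives, these are
    the coefficients obtained by pulling a connection back along a map: they
    are symmetric if the connection and the second derivatives are. *)
Lemma connection_pullback_sym (T : comPzRingType) n (J : 'M[T]_n)
    (H C : 'I_n -> 'M[T]_n) :
  (forall a b j, H a b j = H b a j) -> (forall p q j, C p q j = C q p j) ->
  forall a b j, (H a + J *m (\sum_p J a p *: C p)) b j =
                (H b + J *m (\sum_p J b p *: C p)) a j.
Proof.
move=> HS CS a b j; rewrite 2!mx_addE HS; congr (_ + _).
have E d e : (J *m (\sum_p J d p *: C p)) e j =
    \sum_p \sum_q J e p * J d q * C q p j.
  rewrite mxE; apply: eq_bigr => p _; rewrite summxE mulr_sumr.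
  by apply: eq_bigr => q _; rewrite mxE mulrA.
rewrite !E exchange_big; apply: eq_bigr => p _; apply: eq_bigr => q _ /=.
by rewrite [J b q * _]mulrC (CS p q).
Qed.

(** The pulled back connection is compatible with the pulled back metric J G
    J^T: the left-hand side is the derivative of J G J^T by the product rule
    when that of G is C G + (C G)^T. *)
Lemma connection_pullback_metric (T : comPzRingType) n (J H C G : 'M[T]_n) :
  G^T = G ->
  (H *m G + J *m (C *m G + (C *m G)^T)) *m J^T + J *m G *m H^T =
  (H + J *m C) *m G *m J^T + ((H + J *m C) *m G *m J^T)^T.
Proof.
move=> GT.
have -> : ((H + J *m C) *m G *m J^T)^T = J *m G *m (H^T + C^T *m J^T).
  by rewrite !trmx_mul trmxK GT linearD /= trmx_mul !mulmxA.
rewrite trmx_mul GT !mulmxDl !mulmxDr !mulmxDl !mulmxA -!addrA.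
by congr (_ + _); congr (_ + _); rewrite addrC.
Qed.

Section Charts.
Context {R : realType} {n : nat} {M : topologicalType}.
Variable A : set (chart 'rV[R]_n M).
Hypothesis sA : smooth_structure A.
Implicit Types c : chart 'rV[R]_n M.

Lemma chart_invK c x : A c -> chart_im c x ->
  chart_dom c (chart_inv c x) /\ chart_map c (chart_inv c x) = x.
Proof.
move=> Ac [p cp <-]; have ic := atlas_chart sA Ac.
by rewrite (chart_mapK ic) ?inE.
Qed.

Lemma chart_im_map c p : chart_dom c p -> chart_im c (chart_map c p).
Proof. by move=> cp; exists p. Qed.

Definition overlap c0 c : set 'rV[R]_n :=
  chart_im c0 `&` chart_inv c0 @^-1` chart_dom c.

Definition transition c0 c : 'rV[R]_n -> 'rV[R]_n :=
  chart_map c \o chart_inv c0.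

Definition transition_jacobian c0 c (x : 'rV[R]_n) : 'M[R]_n :=
  'J (transition c0 c) x.

Lemma open_chart_im c : A c -> open (chart_im c).
Proof. by move=> /(atlas_chart sA)/chart_im_open. Qed.

Lemma open_overlap c0 c : A c0 -> A c -> open (overlap c0 c).
Proof.
move=> /(atlas_chart sA) a0 /(atlas_chart sA) a.
apply: open_setI_preimage; [exact: chart_im_open|exact: chart_inv_continuous|].
exact: chart_dom_open.
Qed.

Lemma overlapE c0 c : A c0 ->
  overlap c0 c = chart_map c0 @` (chart_dom c0 `&` idfun @^-1` chart_dom c).
Proof.
move=> A0; apply/seteqP; split=> x.
  move=> [/(chart_invK A0)[d0 E] d]; exists (chart_inv c0 x) => //.
move=> [p [/= p0 p1] <-]; split; first by exists p.
by rewrite /preimage /= (chart_mapK (atlas_chart sA A0)) ?inE.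
Qed.

Lemma smooth_transition c0 c : A c0 -> A c ->
  smooth_on (overlap c0 c) (transition c0 c).
Proof. by move=> A0 A1; rewrite overlapE//; exact: (atlas_compat sA).2. Qed.

Lemma transition_im c0 c x : overlap c0 c x -> chart_im c (transition c0 c x).
Proof. by move=> [_ ?]; exact: chart_im_map. Qed.

Section Connection.
Variable g : pseudo_riemannian A.

(** Row j holds the coordinates of nabla_i e_j. With this convention,
    compatibility with the metric reads 'D_i g = C g + (C g)^T for the matrix
    C, and the inhomogeneous term of the transformation law is the derivative
    of the Jacobian matrix itself. *)
Definition conn c (x : 'rV[R]_n) (i : 'I_n) : 'M[R]_n :=
  \matrix_(j, l) levi_civita g c x l i j.

Lemma smooth_metric_coef c i j : A c ->
  smooth_on (chart_im c) (fun x => g c x i j).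
Proof.
move=> Ac k; have /Ck_on_mxP := metric_smooth g Ac k.
by move=> /(_ (open_chart_im Ac)).
Qed.

Lemma smooth_levi_civita c k i j : A c ->
  smooth_on (chart_im c) (fun x => levi_civita g c x k i j).
Proof.
move=> Ac m; have oc := open_chart_im Ac.
apply: Ck_on_mul => //; first exact: Ck_on_cst.
apply: Ck_on_sum => // l; apply: Ck_on_mul => //.
  apply: Ck_on_invmx => //; first exact: (metric_nondegenerate g Ac).
  by move=> a b; exact: smooth_metric_coef.
have Cd a b d :
    Ck_on m (chart_im c) (fun x => partial d (fun y => g c y a b) x).
  by have [_] := @smooth_metric_coef c a b Ac m.+1; exact.
apply: Ck_on_add => //; first exact: Ck_on_add.
exact: Ck_on_opp.
Qed.

Lemma metric_sym c x i j : A c -> chart_im c x -> g c x i j = g c x j i.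
Proof.
by move=> Ac cx; rewrite -{1}(metric_symmetric g Ac (mem_set cx)) mxE.
Qed.

Lemma differentiable_metric c x : A c -> chart_im c x -> differentiable (g c) x.
Proof.
by move=> Ac cx; exact: Ck_on_differentiable (metric_smooth g Ac 1%N) cx.
Qed.

Lemma conn_sym c x i j k : A c -> chart_im c x ->
  conn c x i j k = conn c x j i k.
Proof.
move=> Ac cx; rewrite !mxE.
by have [_ /(_ (fun _ _ _ => erefl))[H _]] :=
  levi_civitaP g (levi_civita g c x) sA Ac cx.
Qed.

Lemma derive_metric c x i : A c -> chart_im c x ->
  'D_(delta_mx 0 i) (g c) x =
    conn c x i *m g c x + (conn c x i *m g c x)^T.
Proof.
move=> Ac cx; apply/matrixP => a b.
rewrite derive_mxE; last exact: differentiable_metric.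
have [_ /(_ (fun _ _ _ => erefl))[_ H]] :=
  levi_civitaP g (levi_civita g c x) sA Ac cx.
rewrite -[LHS]/(partial i (fun y => g c y a b) x) H !mxE -big_split/=.
by apply: eq_bigr => l _; rewrite !mxE (metric_sym a l).
Qed.

Lemma conn_unique c x (C : 'I_n -> 'M[R]_n) : A c -> chart_im c x ->
  (forall i j k, C i j k = C j i k) ->
  (forall i, 'D_(delta_mx 0 i) (g c) x = C i *m g c x + (C i *m g c x)^T) ->
  forall i, C i = conn c x i.
Proof.
move=> Ac cx Csym CD i; apply/matrixP => j l; rewrite mxE.
have [H _] := levi_civitaP g (fun l i j => C i j l) sA Ac cx.
apply: (fun h => H h l i j); split=> [k a b|k a b]; first exact: Csym.
have := congr1 (fun X : 'M[R]_n => X a b) (CD k).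
rewrite derive_mxE; last exact: differentiable_metric.
rewrite /partial => ->; rewrite !mxE -big_split/=.
by apply: eq_bigr => m _; rewrite (metric_sym a m).
Qed.

Section Transition.
Variables (c0 c : chart 'rV[R]_n M).
Hypotheses (A0 : A c0) (A1 : A c).
Local Notation W := (overlap c0 c).
Local Notation phi := (transition c0 c).
Local Notation J := (transition_jacobian c0 c).

Let oW : open W. Proof. exact: open_overlap. Qed.

Lemma differentiable_transition x : W x -> differentiable phi x.
Proof.
by move=> Wx; exact: Ck_on_differentiable (smooth_transition A0 A1 1%N) Wx.
Qed.

Lemma transition_jacobianE x i a : W x ->
  J x i a = 'D_(delta_mx 0 i) (fun y => phi y 0 a) x.
Proof.
move=> Wx; rewrite -derive_mxE; last exact: differentiable_transition.
rewrite deriveEjacobian; last exact: differentiable_transition.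
by rewrite -rowE [RHS]mxE.
Qed.

Lemma smooth_transition_jacobian k : Ck_on k W J.
Proof.
apply/Ck_on_mxP => // i a.
have /Ck_on_mxP := smooth_transition A0 A1 k.+1; move=> /(_ oW 0 a)[_ H].
apply: Ck_on_eq (H (delta_mx 0 i)) => // x /set_mem Wx.
by rewrite transition_jacobianE.
Qed.

Lemma differentiable_transition_jacobian x : W x -> differentiable J x.
Proof.
by move=> Wx; exact: Ck_on_differentiable (smooth_transition_jacobian 1) Wx.
Qed.

Lemma metric_transition x : W x -> g c0 x = J x *m g c (phi x) *m (J x)^T.
Proof.
move=> [x0 xc]; have [p0 E] := chart_invK A0 x0.
have := metric_tensorial g (c := c0) (c' := c) (p := chart_inv c0 x)
  A0 A1 p0 xc.
by rewrite /local_jacobian E.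
Qed.

(** J is a factor of the invertible matrix of the metric in the first chart. *)
Lemma unitmx_jacobian x : W x -> J x \in unitmx.
Proof.
move=> Wx; have := metric_nondegenerate g A0 (mem_set Wx.1).
by rewrite metric_transition// !unitmx_mul => /andP[/andP[]].
Qed.

(** The entries of J are first derivatives of the transition map, so this is
    the symmetry of its second derivatives. *)
Lemma derive_jacobian_sym x i j k : W x ->
  ('D_(delta_mx 0 i) J x) j k = ('D_(delta_mx 0 j) J x) i k.
Proof.
move=> Wx.
have nE i' j' : ('D_(delta_mx 0 i') J x) j' k =
    'D_(delta_mx 0 i') (fun y => 'D_(delta_mx 0 j') (fun z => phi z 0 k) y) x.
  apply: etrans (derive_mxE _ _ _ (differentiable_transition_jacobian Wx)) _.
  apply: near_eq_derive.
  have : nbhs x W by apply: open_nbhs_nbhs; split.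
  by apply: filterS => y Wy; rewrite transition_jacobianE.
have Cphi : Ck_on 2 W (fun z => phi z 0 k).
  by have /Ck_on_mxP := smooth_transition A0 A1 2; move=> /(_ oW 0 k).
apply: etrans (nE i j) _; apply: etrans _ (esym (nE j i)).
exact: (@derive_commute R _ W (fun z => phi z 0 k) x
  (delta_mx 0 i) (delta_mx 0 j) oW Wx Cphi).
Qed.

(** The transformation law of the connection coefficients. The right-hand side
    times the inverse of J is symmetric and compatible with the metric in the
    chart c0, hence is the Levi-Civita connection there. *)
Lemma conn_transition x i : W x ->
  conn c0 x i *m J x = 'D_(delta_mx 0 i) J x
    + J x *m (\sum_a J x i a *: conn c (phi x) a).
Proof.
move=> Wx; have cx := transition_im Wx.
pose G := g c (phi x).
pose H i := 'D_(delta_mx 0 i) J x.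
pose C i := \sum_a J x i a *: conn c (phi x) a.
pose K i := (H i + J x *m C i) *m invmx (J x).
have HS a b j : H a b j = H b a j by exact: derive_jacobian_sym.
have uJ := unitmx_jacobian Wx.
(* K is the candidate connection in the chart c0, pulled back from c *)
suff KE : forall i, K i = conn c0 x i by rewrite -KE /K mulmxKV.
have GT : G^T = G by exact: (metric_symmetric g A1 (mem_set cx)).
apply: conn_unique => //; first exact: Wx.1.
  move=> a b k; apply: mulmx_entry_eq => j.
  by apply: connection_pullback_sym => // p q r; exact: conn_sym.
move=> a.
have -> : 'D_(delta_mx 0 a) (g c0) x =
    'D_(delta_mx 0 a) (fun y => J y *m g c (phi y) *m (J y)^T) x.
  apply: near_eq_derive; have : nbhs x W by apply: open_nbhs_nbhs; split.
  by apply: filterS => y Wy; rewrite metric_transition.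
have dg : differentiable (g c) (phi x) by exact: differentiable_metric.
have dgp : differentiable (fun y => g c (phi y)) x.
  exact: (differentiable_comp (differentiable_transition Wx) dg).
have dJx := differentiable_transition_jacobian Wx.
have Dg : 'D_(delta_mx 0 a) (fun y => g c (phi y)) x = C a *m G + (C a *m G)^T.
  rewrite derive_comp//; last exact: differentiable_transition.
  rewrite derive_row_sum// /C mulmx_suml (linear_sum trmx) -big_split/=.
  apply: eq_bigr => d _; rewrite derive_metric//.
  rewrite derive_mxE; last exact: differentiable_transition.
  by rewrite -transition_jacobianE// -scalemxAl linearZ /= scalerDr.
rewrite derive_mulmx; [|exact: differentiable_mulmx|exact: differentiable_trmx].
rewrite derive_mulmx// derive_trmx// Dg -/(H a).
have -> : K a *m g c0 x = (H a + J x *m C a) *m G *m (J x)^T.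
  by rewrite metric_transition// -/G /K !mulmxA mulmxKV.
exact: connection_pullback_metric.
Qed.

End Transition.
End Connection.
End Charts.

(** * Geodesics *)

(** Contracting the transformation law of the connection twice with v. *)
Lemma quad_pullback (T : comPzRingType) n (v : 'rV[T]_n) (J : 'M[T]_n)
    (K H C : 'I_n -> 'M[T]_n) :
  (forall i, K i *m J = H i + J *m (\sum_a J i a *: C a)) ->
  (\sum_i v 0 i *: (v *m K i)) *m J =
  v *m (\sum_i v 0 i *: H i) + \sum_a (v *m J) 0 a *: (v *m J *m C a).
Proof.
move=> KJ; rewrite mulmx_suml mulmx_sumr.
have -> : \sum_a (v *m J) 0 a *: (v *m J *m C a) =
    \sum_i v 0 i *: (v *m J *m (\sum_a J i a *: C a)).
  transitivity (\sum_i \sum_a (v 0 i * J i a) *: (v *m J *m C a)).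
    rewrite exchange_big; apply: eq_bigr => a _ /=.
    by rewrite mxE scaler_suml.
  apply: eq_bigr => i _; rewrite mulmx_sumr scaler_sumr.
  by apply: eq_bigr => a _; rewrite -scalemxAr scalerA.
rewrite -big_split; apply: eq_bigr => i _ /=.
by rewrite -scalemxAl -mulmxA KJ mulmxDr scalerDr -scalemxAr mulmxA.
Qed.

Section Geodesics.
Context {R : realType} {n : nat} {M : topologicalType}.
Variable A : set (chart 'rV[R]_n M).
Hypothesis sA : smooth_structure A.
Implicit Types (g : pseudo_riemannian A) (c : chart 'rV[R]_n M).

(** The geodesic equation reads x'' = - conn_quad (x, x'). *)
Definition conn_quad g c (x v : 'rV[R]_n) : 'rV[R]_n :=
  \sum_i v 0 i *: (v *m conn g c x i).

Lemma conn_quadE g c (x v : 'rV[R]_n) k : conn_quad g c x v 0 k =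
  \sum_i \sum_j levi_civita g c x k i j * v 0 i * v 0 j.
Proof.
rewrite /conn_quad summxE; apply: eq_bigr => i _; rewrite !mxE mulr_sumr.
by apply: eq_bigr => j _; rewrite mxE; ring.
Qed.

Lemma conn_quadZ g c (x v : 'rV[R]_n) (s : R) :
  conn_quad g c x (s *: v) = s ^+ 2 *: conn_quad g c x v.
Proof.
rewrite /conn_quad scaler_sumr; apply: eq_bigr => i _.
by rewrite !mxE -scalemxAl !scalerA; congr (_ *: _); ring.
Qed.

Lemma geodesic_eqP g c (x v a : 'rV[R]_n) :
  (forall k, a 0 k + \sum_i \sum_j levi_civita g c x k i j * v 0 i * v 0 j = 0)
  <-> a = - conn_quad g c x v.
Proof.
split=> [H|-> k]; last by rewrite mxE conn_quadE addNr.
apply/rowP => k; have /eqP := H k.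
by rewrite addr_eq0 mxE conn_quadE => /eqP.
Qed.

(** For y = phi o x the chain rule gives y' = x' J and y'' = x'' J + x' (J o
    x)'; the last term cancels the inhomogeneous part of the transformation
    law. *)
Lemma geodesic_transition g c0 c (I : set R) (x : R -> 'rV[R]_n) (t : R) :
  A c0 -> A c -> open I -> I t -> Ck_on 2 I x ->
  (forall s, I s -> overlap c0 c (x s)) ->
  derive1n 2 x t = - conn_quad g c0 (x t) (derive1 x t) ->
  derive1n 2 (transition c0 c \o x) t =
    - conn_quad g c (transition c0 c (x t)) (derive1 (transition c0 c \o x) t).
Proof.
move=> A0 A1 oI It Cx xW eqx.
have dx s : I s -> differentiable x s.
  by move=> Is; exact: Ck_on_differentiable Cx Is.
have Cx' : Ck_on 1 I (fun s => 'D_1 x s) by have [_] := Cx; exact.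
set phi := transition c0 c.
set J := transition_jacobian c0 c.
have D1 s : I s -> derive1 (phi \o x) s = 'D_1 x s *m J (x s).
  move=> Is; rewrite derive1E (derive_comp _ (dx s Is)).
    apply: deriveEjacobian.
    exact: (differentiable_transition sA A0 A1 (xW s Is)).
  exact: (differentiable_transition sA A0 A1 (xW s Is)).
have dJx := differentiable_transition_jacobian sA A0 A1 (xW t It).
have dJ : differentiable (fun s => J (x s)) t.
  exact: (differentiable_comp (dx t It) dJx).
have DJ : 'D_1 (fun s => J (x s)) t =
    \sum_i ('D_1 x t) 0 i *: 'D_(delta_mx 0 i) J (x t).
  by rewrite (derive_comp _ (dx t It) dJx) derive_row_sum.
have DD := derive1n2E x t.
have D2 : derive1n 2 (phi \o x) t =
    derive1n 2 x t *m J (x t) + 'D_1 x t *m 'D_1 (fun s => J (x s)) t.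
  have -> : derive1n 2 (phi \o x) t = 'D_1 (fun s => 'D_1 x s *m J (x s)) t.
    apply: etrans (derive1E _ _) _; apply: near_eq_derive.
    have : nbhs t I by apply: open_nbhs_nbhs; split.
    by apply: filterS => s Is; exact: D1.
  apply: etrans (derive_mulmx _ (Ck_on_differentiable Cx' It) dJ) _.
  by apply: congr2 (congr1 (mulmx^~ _) (esym DD)) _.
apply: etrans D2 _.
rewrite (D1 t It) DJ eqx derive1E mulNmx.
rewrite /conn_quad (quad_pullback _
  (fun i => conn_transition sA g A0 A1 i (xW t It))).
have cancel (a b : 'rV[R]_n) : - (a + b) + a = - b.
  by rewrite opprD addrAC addNr add0r.
exact: cancel.
Qed.

(** The solution of the geodesic equation in the chart c0 is a geodesic of the
    manifold: in another chart c, it satisfies the equation on the open set of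
    times at which it lies in the domain of c. *)
Lemma exists_geodesic g c0 (x0 v : 'rV[R]_n) : A c0 -> chart_im c0 x0 ->
  exists I gamma, [/\ is_geodesic g I gamma, I 0,
    gamma 0 = chart_inv c0 x0 & derive1 (chart_map c0 \o gamma) 0 = v].
Proof.
move=> A0 x0im.
have o0 := open_chart_im sA A0.
have [e e0 [x [xx0 dx Cx xP]]] := geodesic_ode v o0 x0im
  (fun k i j => smooth_levi_civita sA g k i j A0).
pose I := [set t : R | - e < t < e].
pose gamma := chart_inv c0 \o x.
have oI : open I by exact: open_symmetric_itv.
have I0 : I 0 by rewrite /I /=; lra.
have xim t : I t -> chart_im c0 (x t) by move=> /xP[].
have cx : {in I, continuous x}.
  by move=> t tI; exact: (Cx 0%N).
have cgamma : {in I, continuous gamma}.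
  move=> t tI; apply: continuous_comp; first exact: cx.
  apply: (chart_inv_continuous (atlas_chart sA A0)).
  by apply: mem_set; apply: xim; exact: set_mem.
have Igx t : I t -> (chart_map c0 \o gamma) t = x t.
  by move=> /xim/(chart_invK sA A0)[].
have oIc c : A c -> open (I `&` gamma @^-1` chart_dom c).
  move=> Ac; apply: open_setI_preimage => //.
  exact: chart_dom_open (atlas_chart sA Ac).
have xW c t : (I `&` gamma @^-1` chart_dom c) t -> overlap c0 c (x t).
  by move=> [It d]; split=> //; exact: xim.
exists I, gamma; split=> //.
- split=> //.
  + by move=> s t Is It r; move: Is It; rewrite /I /=; lra.
  + by exists 0.
  + move=> c Ac k.
    have CxI : Ck_on k (I `&` gamma @^-1` chart_dom c) x.
      by apply: Ck_on_sub (Cx k) => t [].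
    exact: (Ck_on_comp_mx (oIc c Ac) (open_overlap sA A0 Ac) (xW c) CxI
      (smooth_transition sA A0 Ac k)).
  + move=> c t Ac It ct; apply/geodesic_eqP.
    apply: (@geodesic_transition g c0 c
      (I `&` gamma @^-1` chart_dom c) x t) => //.
    * exact: oIc.
    * by apply: Ck_on_sub (Cx 2) => s [].
    * exact: xW.
    * by apply/geodesic_eqP; have [_] := xP t It.
- by rewrite /gamma /= xx0.
- rewrite -dx !derive1E; apply: near_eq_derive.
  have : nbhs (0 : R) I by apply: open_nbhs_nbhs; split.
  by apply: filterS => s Is; exact: Igx.
Qed.

(** Take the geodesic gamma of g with initial velocity v and write it as sigma
    o tau. In coordinates gamma = z o tau, so that v = tau' w with w = z' and
    gamma'' = tau'^2 z'' + tau'' w. The two geodesic equations and the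
    homogeneity of conn_quad turn this into - Q_g(v) = - Q_gbar(v) + (tau'' /
    tau') v. *)
Lemma conn_quad_reparametrized g gb c (x v : 'rV[R]_n) :
  geodesically_equivalent g gb -> A c -> chart_im c x ->
  exists s, conn_quad gb c x v - conn_quad g c x v = s *: v.
Proof.
move=> ggb Ac cx.
have [I [gamma [gg I0 gamma0 dgamma]]] := exists_geodesic g v Ac cx.
have [J [sigma [gs [tau [Ctau tau0 tauI gammaE]]]]] := ggb I gamma gg.
have [p0 px] := chart_invK sA Ac cx.
have od := chart_dom_open (atlas_chart sA Ac).
pose I' := I `&` gamma @^-1` chart_dom c.
pose J' := J `&` sigma @^-1` chart_dom c.
have oI' : open I'.
  apply: open_setI_preimage => //; first exact: geodesic_open gg.
  exact: geodesic_continuous gg.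
have oJ' : open J'.
  apply: open_setI_preimage => //; first exact: geodesic_open gs.
  exact: geodesic_continuous gs.
have I'0 : I' 0 by split=> //; rewrite /preimage /= gamma0.
have gst t : I t -> gamma t = sigma (tau t).
  by move=> It; exact: gammaE (mem_set It).
have IJ t : I' t -> J' (tau t).
  move=> [It d]; split; first by rewrite -tauI; exists t.
  by rewrite /preimage /= -gst.
pose y := chart_map c \o gamma.
pose z := chart_map c \o sigma.
have Cz : Ck_on 2 J' z by exact: (geodesic_smooth gs Ac 2).
have Ct : Ck_on 2 I' tau by apply: Ck_on_sub (Ctau 2%N) => t [].
have dz t : J' t -> differentiable z t.
  by move=> Jt; exact: Ck_on_differentiable Cz Jt.
have dt t : I' t -> differentiable tau t.
  by move=> It; exact: Ck_on_differentiable Ct It.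
have Cz1 : Ck_on 1 J' (fun s => 'D_1 z s) by have [_] := Cz; exact.
have Ct1 : Ck_on 1 I' (fun s => 'D_1 tau s) by have [_] := Ct; exact.
have nI' t : I' t -> nbhs t I' by move=> It; apply: open_nbhs_nbhs; split.
have Dy t : I' t -> derive1 y t = 'D_1 tau t *: 'D_1 z (tau t).
  move=> It; rewrite derive1E.
  have -> : 'D_1 y t = 'D_1 (fun s => z (tau s)) t.
    apply: near_eq_derive; apply: filterS (nI' t It) => s [Is _].
    by rewrite /y /z /= gst.
  rewrite (derive_comp _ (dt t It) (dz _ (IJ t It))).
  by rewrite derive_real//; exact: dz (IJ t It).
set w := 'D_1 z (tau 0).
set r := 'D_1 tau 0.
have r0 : r != 0 by have := tau0 0 (mem_set I0); rewrite derive1E.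
have vE : v = r *: w by rewrite -dgamma -/y Dy.
have DDy : derive1n 2 y 0 = r ^+ 2 *: derive1n 2 z (tau 0)
    + 'D_1 (fun s => 'D_1 tau s) 0 *: w.
  apply: etrans (derive1E _ _) _.
  have -> : 'D_1 (derive1 y) 0 = 'D_1 (fun t => 'D_1 tau t *: 'D_1 z (tau t)) 0.
    apply: near_eq_derive; apply: filterS (nI' 0 I'0) => s; exact: Dy.
  have dz1 : differentiable (fun s => 'D_1 z s) (tau 0).
    exact: Ck_on_differentiable Cz1 (IJ 0 I'0).
  have dt1 : differentiable (fun s => 'D_1 tau s) 0.
    exact: Ck_on_differentiable Ct1 I'0.
  have dcz := differentiable_comp (dt 0 I'0) dz1.
  have E1 := etrans (derive_comp (1 : R) (dt 0 I'0) dz1) (derive_real _ dz1).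
  apply: etrans (derive_scale _ dt1 dcz) _.
  rewrite derive1n2E expr2 -scalerA.
  by apply: congr2 (congr1 ( *:%R r) E1) _.
have xE : y 0 = x by rewrite /y /= gamma0.
have zE : z (tau 0) = x by rewrite -xE /y /z /= gst.
have eqy : derive1n 2 y 0 = - conn_quad g c x v.
  apply/geodesic_eqP; rewrite -xE -dgamma; apply: (geodesic_eq gg Ac I0).
  exact: I'0.2.
have eqz : derive1n 2 z (tau 0) = - conn_quad gb c x w.
  apply/geodesic_eqP; rewrite -zE /w -derive1E; apply: (geodesic_eq gs Ac).
    exact: (IJ 0 I'0).1.
  exact: (IJ 0 I'0).2.
exists ('D_1 (fun s => 'D_1 tau s) 0 / r).
have Qbv : conn_quad gb c x v = r ^+ 2 *: conn_quad gb c x w.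
  by rewrite vE conn_quadZ.
have := DDy; rewrite eqy eqz scalerN -Qbv => ->.
by rewrite addrA addrN add0r vE scalerA divfK.
Qed.

End Geodesics.

(** * Determinants and projectively trivial tensors *)

Section Jacobi.
Context {R : realType} {V : normedModType R}.

Lemma is_derive_prod (I : eqType) (r : seq I) (F : I -> V -> R) (x v : V)
    (dF : I -> R) : uniq r -> (forall i, is_derive x v (F i) (dF i)) ->
  is_derive x v (fun y => \prod_(i <- r) F i y)
    (\sum_(i <- r) dF i * \prod_(j <- r | j != i) F j x).
Proof.
move=> + DF; elim: r => [_|i r IH /= /andP[ir ur]].
  rewrite big_nil.
  have -> : (fun y => \prod_(i <- [::]) F i y) = cst 1.
    by apply/funext => y; rewrite big_nil.
  exact: is_derive_cst.
have -> : (fun y => \prod_(j <- i :: r) F j y) =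
    F i * (fun y => \prod_(j <- r) F j y).
  by apply/funext => y; rewrite big_cons.
apply: is_derive_eq (is_deriveM (DF i) (IH ur)) _.
rewrite !big_cons eqxx /= addrC; congr (_ + _).
  rewrite [LHS]mulrC; congr (_ * _).
  rewrite [RHS]big_seq_cond [LHS]big_seq_cond.
  apply: eq_bigl => j; rewrite andbT; apply/idP/idP => [jr|/andP[]//].
  by rewrite jr; apply: contraNneq ir => <-.
rewrite [LHS]mulr_sumr; apply: eq_big_seq => k kr.
rewrite big_cons ifT; first by ring.
by apply: contraNneq ir => ->.
Qed.

Lemma is_derive_bigsum (I : Type) (r : seq I) (F : I -> V -> R) (x v : V)
    (dF : I -> R) : (forall i, is_derive x v (F i) (dF i)) ->
  is_derive x v (fun y => \sum_(i <- r) F i y) (\sum_(i <- r) dF i).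
Proof.
move=> DF; elim: r => [|i r IH].
  rewrite big_nil (_ : (fun y => _) = cst 0); first exact: is_derive_cst.
  by apply/funext => y; rewrite big_nil.
rewrite big_cons (_ : (fun y => _) = F i + (fun y => \sum_(j <- r) F j y)).
  exact: is_deriveD.
by apply/funext => y; rewrite big_cons.
Qed.

(** Jacobi's formula. By the Leibniz formula, the derivative of det f is the
    sum over i of the determinants of the matrices B i obtained from f by
    differentiating the i-th row, which are expanded along this row. *)
Lemma derive_det n (f : V -> 'M[R]_n) (x v : V) : differentiable f x ->
  'D_v (fun y => \det (f y)) x = \tr (\adj (f x) *m 'D_v f x).
Proof.
move=> df; have /differentiable_mxP dfij := df.
pose D i j := 'D_v (fun y => f y i j) x.
have Dij i j : is_derive x v (fun y => f y i j) (D i j).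
  by apply: derivableP; apply: diff_derivable; exact: dfij.
pose B i : 'M[R]_n := \matrix_(k, l) if k == i then D k l else f x k l.
have Dprod (s : 'S_n) := is_derive_prod (F := fun i y => f y i (s i))
  (index_enum_uniq _) (fun i => Dij i (s i)).
have -> : 'D_v (fun y => \det (f y)) x = \sum_i \det (B i).
  have [_ ->] := is_derive_bigsum (index_enum _)
    (fun s : 'S_n => is_deriveZ ((-1) ^+ s) (Dprod s)).
  rewrite /determinant exchange_big /=; apply: eq_bigr => s _.
  rewrite -mulr_sumr; congr (_ * _); apply: eq_bigr => k _.
  rewrite [RHS](bigD1 k)//= mxE eqxx; congr (_ * _).
  by apply: eq_bigr => j jk; rewrite mxE (negbTE jk).
rewrite /mxtrace; under [RHS]eq_bigr do rewrite mxE.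
rewrite [RHS]exchange_big; apply: eq_bigr => i _ /=.
rewrite (expand_det_row _ i); apply: eq_bigr => j _.
rewrite !mxE eqxx derive_mxE// mulrC; congr (_ * _).
rewrite /cofactor; congr (_ * \det _); apply/matrixP => a b.
by rewrite !mxE eq_sym (negbTE (neq_lift i a)).
Qed.

End Jacobi.

Section Projective.
Context {R : realType} {n : nat}.

Lemma sum_delta_row (T : 'I_n -> 'rV[R]_n) i :
  \sum_j (delta_mx 0 i : 'rV[R]_n) 0 j *: T j = T i.
Proof.
rewrite (bigD1 i)//= big1 ?addr0 ?mxE ?eqxx ?scale1r// => j ji.
by rewrite mxE (negbTE ji) andbF scale0r.
Qed.

(** Evaluating the hypothesis at the basis vectors e_i kills D^k_ii for k <> i,
    and at e_i + e_j and e_i - e_j it kills D^k_ij for distinct i, j, k and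
    gives D^j_ij = D^i_ii / 2. The trace of D i is then a positive multiple of
    D^i_ii. *)
Lemma projective_traceless_eq0 (D : 'I_n -> 'M[R]_n) :
  (forall i j k, D i j k = D j i k) ->
  (forall v : 'rV[R]_n, exists s, \sum_i v 0 i *: (v *m D i) = s *: v) ->
  (forall i, \tr (D i) = 0) -> forall i, D i = 0.
Proof.
move=> Dsym Dv Dtr.
pose e (i : 'I_n) : 'rV[R]_n := delta_mx 0 i.
have eE i k : e i 0 k = (k == i)%:R by rewrite mxE.
have Qe i k : (\sum_j e i 0 j *: (e i *m D j)) 0 k = D i i k.
  by rewrite sum_delta_row -rowE mxE.
have Qes i j (s : R) k : let v := e i + s *: e j in
    (\sum_a v 0 a *: (v *m D a)) 0 k =
    D i i k + 2 * s * D i j k + s ^+ 2 * D j j k.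
  move=> v; have -> : \sum_a v 0 a *: (v *m D a) = v *m D i + s *: (v *m D j).
    rewrite -(sum_delta_row (fun a => v *m D a) i).
    rewrite -(sum_delta_row (fun a => v *m D a) j).
    rewrite scaler_sumr -big_split; apply: eq_bigr => a _ /=.
    by rewrite scalerA -scalerDl !mxE.
  by rewrite !mulmxDl -!scalemxAl -!rowE !mxE (Dsym j i); ring.
have ev i j (s t : R) k : (t *: (e i + s *: e j)) 0 k =
    t * ((k == i)%:R + s * (k == j)%:R) by rewrite !mxE.
have Dii i k : k != i -> D i i k = 0.
  move=> ki; have [s /rowP/(_ k)] := Dv (e i).
  by rewrite Qe mxE eE (negbTE ki) mulr0.
have Dijk i j k : i != j -> k != i -> k != j -> D i j k = 0.
  move=> ij ki kj; have [s /rowP/(_ k)] := Dv (e i + 1 *: e j).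
  rewrite Qes !Dii// ev (negbTE ki) (negbTE kj) /= !mulr0 !addr0 !mulr0; lra.
have Dhalf i j : i != j -> D i j j = D i i i / 2.
  move=> ij.
  have H s : s * (D i i i + 2 * s * D i j i) =
      2 * s * D i j j + s ^+ 2 * D j j j.
    have [l /rowP El] := Dv (e i + s *: e j).
    have := El i; have := El j; rewrite !Qes.
    rewrite (Dii j i)// (Dii i j) 1?eq_sym// !ev !eqxx (negbTE ij).
    rewrite [j == i]eq_sym (negbTE ij) /=.
    rewrite !mulr0 !addr0 !add0r !mulr1 => El1 El2.
    have -> : D i i i + 2 * s * D i j i = l by rewrite -El2; ring.
    by rewrite mulrC -El1.
  have := H 1; have := H (-1); lra.
have Diii i : D i i i = 0.
  have := Dtr i; rewrite /mxtrace (bigD1 i)//=.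
  have -> : \sum_(j < n | j != i) D i j j = \sum_(j < n | j != i) D i i i / 2.
    by apply: eq_bigr => j ji; rewrite Dhalf// eq_sym.
  rewrite sumr_const -mulr_natr => H.
  have : D i i i * (1 + #|[pred j | j != i]|%:R / 2) = 0.
    by rewrite -[RHS]H; field.
  move/eqP; rewrite mulf_eq0 => /orP[/eqP//|/eqP H0].
  have : (0 : R) <= #|[pred j | j != i]|%:R by [].
  lra.
move=> i; apply/matrixP => j k; rewrite mxE.
have [->|ij] := eqVneq i j.
  by have [->|kj] := eqVneq k j; [exact: Diii|exact: Dii].
have [->|ki] := eqVneq k i; first by rewrite Dsym Dhalf ?Diii ?mul0r// eq_sym.
have [->|kj] := eqVneq k j; first by rewrite Dhalf// Diii mul0r.
exact: Dijk.
Qed.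

End Projective.

(** * Homogeneous spaces *)

Section Trace.
Context {R : realType} {n : nat} {M : topologicalType}.
Variable A : set (chart 'rV[R]_n M).
Hypothesis sA : smooth_structure A.

(** Jacobi's formula and the compatibility of g with its connection; the two
    terms of the derivative of g have the same trace against the adjugate,
    since g is symmetric. *)
Lemma derive_det_metric (g : pseudo_riemannian A) c (x : 'rV[R]_n) i :
  A c -> chart_im c x ->
  'D_(delta_mx 0 i) (fun y => \det (g c y)) x =
    2 * \tr (conn g c x i) * \det (g c x).
Proof.
move=> Ac cx; rewrite derive_det; last exact: differentiable_metric.
rewrite derive_metric//; set C := conn g c x i.
have gT : (g c x)^T = g c x by exact: (metric_symmetric g Ac (mem_set cx)).
have E : \tr (\adj (g c x) *m (C *m g c x)) = \tr C * \det (g c x).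
  by rewrite mxtrace_mulC -mulmxA mul_mx_adj mul_mx_scalar mxtraceZ mulrC.
rewrite mulmxDr mxtraceD E -[\tr (_ *m _^T)]mxtrace_tr.
rewrite trmx_mul trmxK trmx_adj gT.
by rewrite mxtrace_mulC E; ring.
Qed.

(** Both traces are half the logarithmic derivative of the determinant, which
    does not see the factor K. *)
Lemma trace_conn_eq (g gb : pseudo_riemannian A) c (x : 'rV[R]_n) (K : R) i :
  A c -> chart_im c x ->
  (forall y, chart_im c y -> \det (gb c y) = K * \det (g c y)) ->
  \tr (conn gb c x i) = \tr (conn g c x i).
Proof.
move=> Ac cx gK.
have dg : differentiable (fun y => \det (g c y)) x.
  have oc := open_chart_im sA Ac.
  have Cd : Ck_on 1 (chart_im c) (fun y => \det (g c y)).
    by apply: Ck_on_det => // a b; exact: smooth_metric_coef.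
  exact: Ck_on_differentiable Cd cx.
have : 'D_(delta_mx 0 i) (fun y => \det (gb c y)) x =
       K * 'D_(delta_mx 0 i) (fun y => \det (g c y)) x.
  have dd : derivable (fun y => \det (g c y)) x (delta_mx 0 i).
    exact: diff_derivable.
  apply: etrans _ (deriveZ K dd); apply: near_eq_derive.
  have : nbhs x (chart_im c).
    by apply: open_nbhs_nbhs; split; [exact: (open_chart_im sA Ac)|].
  by apply: filterS => y; exact: gK.
rewrite (derive_det_metric gb i Ac cx) (derive_det_metric g i Ac cx).
rewrite (gK x cx) => H.
have : \det (gb c x) != 0.
  rewrite -unitfE -unitmxE.
  exact: (metric_nondegenerate gb Ac (mem_set cx)).
rewrite (gK x cx) => K0; apply: (mulIf K0).
have aux (a b k d : R) : 2 * a * (k * d) = k * (2 * b * d) ->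
    a * (k * d) = b * (k * d) by lra.
exact: aux H.
Qed.

End Trace.

Section Homogeneous.
Context {R : realType} {m n : nat} {G : lieGroupType R m} {H : groupClosed G}.

Lemma ltranslation_transitive (p q : coset_space H) :
  exists a : G, ltranslation a p = q.
Proof.
have reprE (r : coset_space H) : coset_proj H (repr r) = r by exact: reprK.
exists (repr q * (repr p)^-1)%g.
have := ltranslationE H (repr q * (repr p)^-1)%g (repr p).
by rewrite !reprE -mulgA mulVg mulg1 reprE.
Qed.

Variable A : set (chart 'rV[R]_n (coset_space H)).
Hypothesis sA : smooth_structure A.

(** An isometry carrying one point to the other multiplies the determinants of
    both metrics by the square of the same Jacobian determinant. *)
Lemma invariant_det_ratio (g gb : pseudo_riemannian A) c (x y : 'rV[R]_n) :
  invariant_metric g -> invariant_metric gb -> A c ->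
  chart_im c x -> chart_im c y ->
  \det (gb c x) * \det (g c y) = \det (gb c y) * \det (g c x).
Proof.
move=> ig igb Ac cx cy.
have [px xE] := chart_invK sA Ac cx; have [py yE] := chart_invK sA Ac cy.
have [a aE] := ltranslation_transitive (chart_inv c x) (chart_inv c y).
have pa : chart_dom c (ltranslation a (chart_inv c x)) by rewrite aE.
have := (ig a).2 c c _ Ac Ac px pa; have := (igb a).2 c c _ Ac Ac px pa.
rewrite aE xE yE => -> ->; rewrite !det_mulmx; ring.
Qed.

End Homogeneous.

Theorem theorem2p1 (R : realType) (m n : nat) (G : lieGroupType R m)
    (H : groupClosed G) (H_closed : closed [set x : G | x \in H]%classic)
    (n_ge2 : (2 <= n)%N)
    (A : set (chart 'rV[R]_n (coset_space H)))
    (GH_manifold : homogeneous_structure A)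
    (GH_connected : connected [set: coset_space H]%classic)
    (g gbar : pseudo_riemannian A)
    (g_invariant : invariant_metric g)
    (gbar_invariant : invariant_metric gbar) :
  geodesically_equivalent g gbar -> affinely_equivalent g gbar.
Proof.
move=> ggb c Ac x cx k i j.
have sA := GH_manifold.1.
have det0 : \det (g c x) != 0.
  by rewrite -unitfE -unitmxE; exact: (metric_nondegenerate g Ac (mem_set cx)).
have detK y : chart_im c y ->
    \det (gbar c y) = \det (gbar c x) / \det (g c x) * \det (g c y).
  move=> cy; apply: (mulIf det0).
  rewrite (invariant_det_ratio sA g_invariant gbar_invariant Ac cy cx).
  by rewrite mulrAC divfK.
pose D i := conn gbar c x i - conn g c x i.
suff /(_ i)/eqP : forall i, D i = 0.
  rewrite subr_eq0 => /eqP/matrixP/(_ j k).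
  by rewrite !mxE => ->.
apply: projective_traceless_eq0 => [a b d|v|a].
- have submxE (X Y : 'M[R]_n) p q : (X - Y) p q = X p q - Y p q.
    by rewrite !mxE.
  by rewrite /D 2!submxE; congr (_ - _); exact: conn_sym.
- have [s sE] := conn_quad_reparametrized sA v ggb Ac cx.
  exists s; rewrite -sE /conn_quad -sumrB; apply: eq_bigr => a _.
  by rewrite /D mulmxBr scalerBr.
- by rewrite /D linearB /= (trace_conn_eq sA _ Ac cx detK) subrr.
Qed.
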